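(* Let $(L,\delta_L^* )$ be an iterative $q$-difference field whose field of constants $C(L)$ is algebraically closed, and let $(M,\delta_M^* )$ be an iterative $q$-difference module over $L$. Then there exists an iterative $q$-difference Picard–Vessiot ring for $M$ over $L$, and it is unique up to isomorphism of iterative $q$-difference rings over $L$ (i.e. up to an $L$-algebra isomorphism commuting with all the operators $\delta^{(k)}$).
   Context: Let $C$ be an algebraically closed field and let $q\in C$ be a primitive $n$-th root of unity, $n\ge 2$. Let $F=C(t)$ with the automorphism $\sigma_q(f(t))=f(qt)$. For $r,k\in\mathbb N$ let $\binom{r}{k}_q$ be the Gaussian binomial coefficient, i.e. the value at $q$ of the polynomial $\prod_{i=1}^{k}\frac{1-x^{r-i+1}}{1-x^{i}}\in\mathbb Z[x]$ (it is $0$ if $k>r$). An iterative $q$-difference ring ($ID_q$-ring) is a commutative $F$-algebra $R$ with a ring automorphism $\sigma_q$ extending $\sigma_q$ of $F$ and a family $\delta_R^*=(\delta_R^{(k)})_{k\in\mathbb N}$ of maps $R\to R$ such that for all $a,b\in R$, $i,j,k\in\mathbb N$: $\delta_R^{(0)}=\mathrm{id}$; $\delta_R^{(1)}=\frac{\sigma_q-\mathrm{id}}{(q-1)t}$; $\delta_R^{(k)}$ is additive; $\delta_R^{(k)}(ab)=\sum_{i+j=k}\sigma_q^i(\delta_R^{(j)}(a))\,\delta_R^{(i)}(b)$; $\delta_R^{(i)}\circ\delta_R^{(j)}=\binom{i+j}{i}_q\delta_R^{(i+j)}$. Its constants are $C(R)=\{c\in R:\delta_R^{(k)}(c)=0\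 \forall k\ge1\}$. An $ID_q$-field is an $ID_q$-ring that is a field. An $ID_q$-ideal is an ideal stable under all $\delta_R^{(k)}$; $R$ is $ID_q$-simple if its only $ID_q$-ideals are $0$ and $R$. An $ID_q$-extension of an $ID_q$-field $L$ is an $ID_q$-ring $R\supseteq L$ whose $\sigma_q$ and $\delta_R^{(k)}$ restrict to those of $L$. An iterative $q$-difference module over $L$ is a finite-dimensional $L$-vector space $M$ with maps $\delta_M^{(k)}:M\to M$ ($k\in\mathbb N$) such that $\delta_M^{(0)}=\mathrm{id}$; $\phi_M:=(q-1)t\,\delta_M^{(1)}+\mathrm{id}_M$ is bijective; each $\delta_M^{(k)}$ is additive; $\delta_M^{(k)}(am)=\sum_{i+j=k}\sigma_q^i(\delta_L^{(j)}(a))\,\delta_M^{(i)}(m)$ for $a\in L$, $m\in M$; $\delta_M^{(i)}\circ\delta_M^{(j)}=\binom{i+j}{i}_q\delta_M^{(i+j)}$. Fix an $L$-basis $e_1,\dots,e_r$ of $M$ and let $G_i\in M_r(L)$ be the matrix of $\delta_M^{(i)}$, i.e. $\delta_M^{(i)}(e_j)=\sum_l (G_i)_{lj}e_l$ (so $G_0=I$). For an $ID_q$-extension $R$ of $L$, a matrix $Y\in GL_r(R)$ is a fundamental solution matrix for (the iterative $q$-difference equation of) $M$ if $\sum_{i+j=k}G_i\,\sigma_q^i(\delta_R^{(j)}(Y))=0$ for all $k\ge1$ (operators applied entrywise), i.e. each column $y$ of $Y$ gives an element $\sum_l y_le_l$ annihilated by all $\delta^{(k)}$, $k\ge1$. An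 iterative $q$-difference Picard–Vessiot ring for $M$ over $L$ is an $ID_q$-extension $R$ of $L$ such that: $R$ is $ID_q$-simple; there is a fundamental solution matrix $Y\in GL_r(R)$ for $M$; $R$ is generated as $L$-algebra by the entries of $Y$ and $\det(Y)^{-1}$; and $C(R)=C(L)$. *)

(* Defs.v *)
From HB Require Import structures.
From mathcomp Require Import all_boot all_order all_algebra.
From mathcomp Require Import generic_quotient fraction.
Set Implicit Arguments. Unset Strict Implicit. Unset Printing Implicit Defensive.
Import Order.TTheory GRing.Theory Num.Theory.
Local Open Scope ring_scope.
Local Open Scope quotient_scope.

Definition Ct (C : closedFieldType) : fieldType := {fraction {poly C}}.

Definition tF (C : closedFieldType) : Ct C := tofrac ('X : {poly C}).

Definition cF (C : closedFieldType) (c : C) : Ct C := tofrac (c%:P).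

Definition sigmaF (C : closedFieldType) (q : C) (f : Ct C) : Ct C :=
  let r := repr f in
  tofrac ((\n_r) \Po (q *: 'X)) / tofrac ((\d_r) \Po (q *: 'X)).

(* Gaussian binomial polynomial prod_{i=1}^k (1 - x^(r-i+1)) / (1 - x^i) in Z[x]
   (the division is exact; the divisor has unit leading coefficient). *)
Definition qbinom_poly (r k : nat) : {poly int} :=
  (\prod_(i < k) (1 - 'X^(r - i))) %/ (\prod_(i < k) (1 - 'X^(i.+1))).

Definition qbinom (C : closedFieldType) (q : C) (r k : nat) : C :=
  (map_poly (fun z : int => z%:~R) (qbinom_poly r k)).[q].

Definition IDq_ring (C : closedFieldType) (q : C) (R : comNzRingType)
    (iF : {rmorphism Ct C -> R}) (s : R -> R) (d : nat -> R -> R) : Prop :=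
  ((
      (forall a b, s (a + b) = s a + s b)) /\
      ((forall a b, s (a * b) = s a * s b)) /\
      (s 1 = 1) /\
      (bijective s) /\
      ((forall f, s (iF f) = iF (sigmaF q f))) /\
      (
      (forall a, d 0%N a = a)) /\
      ((forall a, d 1%N a = (s a - a) * iF (((cF (q - 1)) * tF C)^-1))) /\
      ((forall k a b, d k (a + b) = d k a + d k b)) /\
      ((forall k a b, d k (a * b) =
          \sum_(i < k.+1) iter i s (d (k - i)%N a) * d i b)) /\
      ((forall i j a, d i (d j a) = iF (cF (qbinom q (i + j) i)) * d (i + j)%N a))).

Definition is_const (R : Type) (d : nat -> R -> R) (zero : R) (c : R) : Prop :=
  forall k, (0 < k)%N -> d k c = zero.

Definition IDq_field_algclosed_consts (C : closedFieldType) (q : C) (L : fieldType)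
    (iL : {rmorphism Ct C -> L}) (sL : L -> L) (dL : nat -> L -> L) : Prop :=
  IDq_ring q iL sL dL /\
  (forall p : {poly L}, (forall i, is_const dL 0 p`_i) -> (1 < size p)%N ->
      exists2 x, is_const dL 0 x & root p x).

Definition IDq_module (C : closedFieldType) (q : C) (L : fieldType)
    (iL : {rmorphism Ct C -> L}) (sL : L -> L) (dL : nat -> L -> L)
    (M : vectType L) (dM : nat -> M -> M) : Prop :=
  (((forall m, dM 0%N m = m)) /\
      (bijective (fun m => iL (cF (q - 1) * tF C) *: dM 1%N m + m)) /\
      ((forall k m m', dM k (m + m') = dM k m + dM k m')) /\
      ((forall k (a : L) m, dM k (a *: m) =
          \sum_(i < k.+1) iter i sL (dL (k - i)%N a) *: dM i m)) /\
      ((forall i j m, dM i (dM j m) = iL (cF (qbinom q (i + j) i)) *: dM (i + j)%N m))).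

Definition delta_mx (L : fieldType) (M : vectType L) (dM : nat -> M -> M)
    (e : (\dim (fullv : {vspace M})).-tuple M) (i : nat)
    : 'M[L]_(\dim (fullv : {vspace M})) :=
  \matrix_(l, j) coord e l (dM i (e`_j)).

Definition IDq_ext (C : closedFieldType) (q : C) (L : fieldType)
    (iL : {rmorphism Ct C -> L}) (sL : L -> L) (dL : nat -> L -> L)
    (R : comNzRingType) (j : {rmorphism L -> R}) (s : R -> R) (d : nat -> R -> R)
    : Prop :=
  ((IDq_ring q (j \o iL) s d) /\
      ((forall a, s (j a) = j (sL a))) /\
      ((forall k a, d k (j a) = j (dL k a)))).

Definition is_ideal (R : comNzRingType) (I : R -> Prop) : Prop :=
  ((I 0) /\
      ((forall x y, I x -> I y -> I (x + y))) /\
      ((forall r x, I x -> I (r * x)))).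

Definition IDq_simple (R : comNzRingType) (d : nat -> R -> R) : Prop :=
  forall I : R -> Prop, is_ideal I -> (forall k x, I x -> I (d k x)) ->
    (forall x, I x -> x = 0) \/ (forall x, I x).

Definition IDq_PV_ring (C : closedFieldType) (q : C) (L : fieldType)
    (iL : {rmorphism Ct C -> L}) (sL : L -> L) (dL : nat -> L -> L)
    (M : vectType L) (dM : nat -> M -> M)
    (e : (\dim (fullv : {vspace M})).-tuple M)
    (R : comNzRingType) (j : {rmorphism L -> R}) (s : R -> R) (d : nat -> R -> R)
    (Y : 'M[R]_(\dim (fullv : {vspace M}))) : Prop :=
  ((IDq_ext q iL sL dL j s d) /\
      (IDq_simple d) /\
      (
      (exists Z, Y *m Z = 1%:M /\ Z *m Y = 1%:M)) /\
      (
      (forall k, (0 < k)%N ->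
         \sum_(i < k.+1) map_mx j (delta_mx dM e i) *m
                         map_mx (iter i s) (map_mx (d (k - i)%N) Y) = 0)) /\
      (
      (forall S : R -> Prop,
         (forall l, S (j l)) ->
         (forall x y, S x -> S y -> S (x + y)) ->
         (forall x y, S x -> S y -> S (x * y)) ->
         (forall a b, S (Y a b)) ->
         (forall u, u * \det Y = 1 -> S u) ->
         forall x, S x)) /\
      (
      (forall c : R, is_const d 0 c <-> exists2 l, is_const dL 0 l & j l = c))).

(* Main.v *)
(* q-Taylor expansion at a point maps every iterative q-difference ring R, along
   any ring morphism u : R -> Om, to a cofree object W(Om): the completion of
   Om[x] along the points u(t), q u(t), q^2 u(t), ... with its q-divided differences.
   Existence: the matrices of the operators of M are the q-Taylor coefficients of
   an invertible matrix A over W(L), and A^-1 is a fundamental solution matrix;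
   the ring generated by its entries is divided by a maximal stable ideal.
   Uniqueness: two Picard-Vessiot rings R1, R2 are mapped to W(R1 (x)_L R2), hence
   into a common simple ring, where their fundamental matrices differ by a
   constant matrix, so that their images coincide.
   Both parts need that a simple, finitely generated extension of L has no new
   constants: for a constant c transcendental over L every c - a with a in C(L)
   would be a unit, which the argument of Zariski's lemma allows only for finitely
   many a; a constant algebraic over L has a minimal polynomial with constant
   coefficients. *)
Require Import Defs.
From HB Require Import structures.
From mathcomp Require Import all_boot all_order all_algebra.
From mathcomp Require Import generic_quotient fraction ring_quotient.
From mathcomp Require Import boolp mpoly.
From mathcomp Require classical_sets.
From mathcomp Require Import zify ring.
Import Order.TTheory GRing.Theory Num.Theory.
Local Open Scope ring_scope.
Set Implicit Arguments.
Unset Strict Implicit.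

(** * Maximal ideals, quotients and subrings *)

(** Defining the operators by hand on L[X, 1/det X] or on R1 (x)_L R2 would mean checking the skew
    Leibniz and iteration rules on rings given by generators and relations. In W they are checked
    once: polynomials are dense there, so these rules reduce to identities in R[x], and those to
    q-binomial identities. The latter are proved in Z[x], because the q-factorials vanish at a root
    of unity. Subrings and quotients inherit the axioms except for the bijectivity of the shift,
    which follows from sigma^n = id. The expansion is multiplicative and commutes with the shift
    only if t and q behave as in C[t]. The axioms give delta^(1)(t) = 1; that delta^(k)(t) = 0 for k
    > 1, and that q is a constant, has to be derived, using that n is invertible in C. The simple
    quotient is taken of a finitely generated subring and not of W, since the argument on constants
    rests on finite generation. Simple rings are not shown to be domains; therefore Zariski's
    argument is run in a further quotient, in which nonzero polynomials in the constant c
    survive. *)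

Definition stable_subgroup (V : zmodType) (K : Type) (op : K -> V -> V)
    (I : V -> Prop) : Prop :=
  [/\ I 0, forall x y, I x -> I y -> I (x + y) &
      forall k x, I x -> I (op k x)].

(** One use of Zorn's lemma for three kinds of objects: with multiplications as [op], ideals missing
    a set; with the delta^(k) added, proper ID_q-ideals; with scalars from L, subspaces missing
    1. *)
Lemma exists_maximal_stable (V : zmodType) (K : Type) (op : K -> V -> V)
    (avoid : V -> Prop) :
    (forall k, op k 0 = 0) -> ~ avoid 0 ->
  exists I : V -> Prop, [/\ stable_subgroup op I, forall x, I x -> ~ avoid x &
    forall J : V -> Prop, stable_subgroup op J -> (forall x, I x -> J x) ->
      (forall x, J x -> ~ avoid x) -> forall x, J x -> I x].
Proof.
move=> op0 av0.
(* [P] does not ask for 0, so that it holds for the empty set, the union of the empty chain. A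
   maximal set contains 0 because adjoining 0 preserves [P]. *)
pose P (X : V -> Prop) := [/\ forall x y, X x -> X y -> X (x + y),
  forall k x, X x -> X (op k x) & forall x, X x -> ~ avoid x].
have chainP F : classical_sets.subset F P ->
    classical_sets.total_on F classical_sets.subset ->
    P (classical_sets.bigcup F id).
  move=> FP Ftot; split.
  - move=> x y [X FX Xx] [X' FX' X'y].
    have [XX'|X'X] := Ftot _ _ FX FX'.
      by exists X' => //; have [+ _ _] := FP _ FX'; apply=> //; exact: XX'.
    by exists X => //; have [+ _ _] := FP _ FX; apply=> //; exact: X'X.
  - by move=> k x [X FX Xx]; exists X => //; have [_ + _] := FP _ FX; apply.
  - by move=> x [X FX Xx]; have [_ _ +] := FP _ FX; apply.
have [I [[ID Iop Iav] Imax]] := classical_sets.Zorn_bigcup chainP.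
have max J : P J -> (forall x, I x -> J x) -> forall x, J x -> I x.
  move=> PJ IJ x Jx; apply: contrapT => nIx; apply: (Imax J) => //.
  by split=> // /(_ _ Jx).
have I0 : I 0.
  apply: (max (fun x => I x \/ x = 0)); [|by left|by right].
  split.
  - by move=> x y [Ix|->] [Iy|->]; rewrite ?addr0 ?add0r; auto.
  - by move=> k x [Ix|->]; [left; apply: Iop|right].
  - by move=> x [Ix|->] //; apply: Iav.
by exists I; split=> // J [J0 JD Jop] IJ Jav; apply: max.
Qed.

Section QuotientByIdeal.
Variables (R : comNzRingType) (I : R -> Prop).
Hypotheses (idI : is_ideal I) (I1 : ~ I 1).

Definition mem_ideal (x : R) : bool := `[< I x >].

Lemma mem_ideal_closed : idealr_closed (mem_ideal : {pred R}).
Proof.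
have [I0 [ID IM]] := idI.
split; [exact/asboolP|exact/asboolP|].
move=> a u v /asboolP Iu /asboolP Iv; apply/asboolP.
by apply: ID => //; apply: IM.
Qed.

HB.instance Definition _ := isIdealr.Build R mem_ideal mem_ideal_closed.

Lemma exists_quotient :
  exists (T : comNzRingType) (p : {rmorphism R -> T}),
    (forall y, exists x, p x = y) /\ (forall x, p x = 0 <-> I x).
Proof.
pose J : idealr R := mem_ideal.
exists {ideal_quot J}, (\pi_{ideal_quot J})%qT; split.
  by move=> y; exists (repr y); exact: reprK.
move=> x; have := Quotient.idealrBE J x 0; rewrite subr0 => E.
split=> [px|Ix].
  apply/asboolP; rewrite -/(mem_ideal x) -[mem_ideal x]/(x \in J) E.
  by apply/eqP; apply: etrans px (esym (rmorph0 _)).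
have : x \in J by apply/asboolP.
by rewrite E => /eqP px; apply: etrans px (rmorph0 _).
Qed.

End QuotientByIdeal.

Definition is_subring (R : pzRingType) (S : R -> Prop) : Prop :=
  [/\ S 1, forall x y, S x -> S y -> S (x - y) &
      forall x y, S x -> S y -> S (x * y)].

Section SubringType.
Variables (R : comNzRingType) (S : R -> Prop).
Hypothesis ringS : is_subring S.

Definition mem_subring (x : R) : bool := `[< S x >].

Lemma mem_subring_closed : subring_closed (mem_subring : {pred R}).
Proof.
have [S1 SB SM] := ringS.
by split=> [|x y /asboolP ? /asboolP ?|x y /asboolP ? /asboolP ?];
  apply/asboolP; auto.
Qed.

Definition subring_type := {x : R | mem_subring x}.

HB.instance Definition _ := [isSub of subring_type for @sval R mem_subring].
HB.instance Definition _ := [Choice of subring_type by <:].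
HB.instance Definition _ := GRing.SubChoice_isSubComNzRing.Build R mem_subring subring_type mem_subring_closed.

Lemma exists_subring_type :
  exists (T : comNzRingType) (i : {rmorphism T -> R}),
    injective i /\ (forall x, S x <-> exists y, i y = x).
Proof.
exists subring_type, (val : subring_type -> R); split; first exact: val_inj.
move=> x; split=> [Sx|[y <-]]; last by apply/asboolP; exact: (valP y).
by exists (Sub x (asboolT Sx) : subring_type); exact: SubK.
Qed.

End SubringType.

(** * Zariski's lemma and generic units *)

Definition generated (A : Type) (R : pzRingType) (i : A -> R) (ys : seq R) : Prop :=
  forall S : R -> Prop, (forall a, S (i a)) ->
    (forall x y, S x -> S y -> S (x + y)) ->
    (forall x y, S x -> S y -> S (x * y)) ->
    (forall y, y \in ys -> S y) -> forall x, S x.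

(** Multiply the monic equation of v, of degree N, by p^N and replace p v by w: every term but w^N
    keeps a factor p. *)
Lemma integral_quotient_dvd (A B : comNzRingType) (i : {rmorphism A -> B})
    (p w : A) (v : B) :
    injective i -> integralOver i v -> i p * v = i w ->
  exists N g, w ^+ N = p * g.
Proof.
move=> i_inj [f mf /rootP fv] pvw.
have sf : size f = (size f).-1.+1 by rewrite prednK // size_poly_gt0 monic_neq0.
set N := (size f).-1 in sf; exists N.
exists (- \sum_(k < N) f`_k * p ^+ (N - k).-1 * w ^+ k).
have fN : f`_N = 1 by move/monicP: mf.
apply: (i_inj); apply/eqP; rewrite mulrN rmorphN -addr_eq0 addrC; apply/eqP.
move: fv; rewrite horner_coef size_map_inj_poly ?rmorph0 // sf.
move=> /(congr1 (fun z => i p ^+ N * z)); rewrite mulr0 big_ord_recr /= => E.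
rewrite -[RHS]E mulrDr {E} mulr_sumr; congr (_ + _); last first.
  by rewrite coef_map /= fN rmorph1 mul1r -exprMn pvw rmorphXn.
rewrite mulr_sumr rmorph_sum; apply: eq_bigr => k _.
rewrite coef_map !rmorphM !rmorphXn /= -pvw exprMn.
have kN : (k <= N)%N by apply: ltnW.
have -> : i p ^+ N = i p * i p ^+ (N - k).-1 * i p ^+ k.
  by rewrite -exprS prednK ?subn_gt0 // -exprD subnK.
ring.
Qed.

(** With a the leading coefficient and N the degree, a^(N-1) p(y) is a monic polynomial expression
    in a y. *)
Lemma algebraic_scaled_integral (A B : comNzRingType) (i : {rmorphism A -> B})
    (p : {poly A}) (y : B) :
    injective i -> p != 0 -> (map_poly i p).[y] = 0 ->
  integralOver i (i (lead_coef p) * y).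
Proof.
move=> i_inj p0 py.
have sp : size p = (size p).-1.+1 by rewrite prednK // size_poly_gt0.
set N := (size p).-1 in sp.
have N0 : (0 < N)%N.
  rewrite lt0n; apply: contra_eq_neq py => N0.
  have /size_poly1P[c c0 ->] : size p == 1 by rewrite sp N0.
  by rewrite map_polyC hornerC; apply: contra_neq c0 => ic; apply: (i_inj);
     rewrite ic rmorph0.
set a := lead_coef p.
exists ('X^N + \poly_(k < N) (p`_k * a ^+ (N - k).-1)).
  apply/monicP; rewrite lead_coefDl ?lead_coefXn //.
  by rewrite size_polyXn ltnS size_poly.
apply/rootP; rewrite rmorphD /= map_polyXn hornerD hornerXn.
rewrite (@horner_coef_wide _ N); last first.
  by apply: leq_trans (size_poly _ _) _; rewrite size_poly.
move: py; rewrite horner_coef size_map_inj_poly ?rmorph0 // sp.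
move=> /(congr1 (fun z => i a ^+ N.-1 * z)); rewrite mulr0 big_ord_recr /= => E.
rewrite -[RHS]E mulrDr {E} addrC; congr (_ + _).
  rewrite mulr_sumr; apply: eq_bigr => k _.
  rewrite !coef_map coef_poly ltn_ord /= rmorphM rmorphXn exprMn.
  have -> : i a ^+ N.-1 = i a ^+ (N - k).-1 * i a ^+ k.
    by rewrite -exprD; congr (_ ^+ _); have := ltn_ord k; lia.
  ring.
rewrite coef_map -/N -/(lead_coef p) -/a /= exprMn mulrA -exprSr prednK //.
Qed.

(* If a generator y were transcendental over A, the induction hypothesis over A[y] would
   give some f' in A[y] with B integral over A[y][1/f']; but 1 + y f', prime to f',
   divides a nonzero element of A, which forces it to be constant. *)
Lemma localization_integral (A : idomainType) (B : comNzRingType)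
    (i : {rmorphism A -> B}) (ys : seq B) :
    injective i ->
    (forall b : B, b != 0 -> exists (b' : B) (a : A), a != 0 /\ b * b' = i a) ->
    generated i ys ->
  exists2 f : A, f != 0 & forall b, exists k, integralOver i (i f ^+ k * b).
Proof.
move: {2}(size ys) (erefl (size ys)) => m.
elim: m => [|m IH] in A B i ys *; move=> sys i_inj iD gen.
  have ys0 : ys = [::] by case: (ys) sys.
  exists 1; first exact: oner_neq0.
  move=> b; exists 0; rewrite mul1r.
  apply: gen b => [a|x y|x y|y]; [exact: integral_id|exact: integral_add|
    exact: integral_mul|by rewrite ys0].
have alg y : y \in ys -> exists2 p : {poly A}, p != 0 & (map_poly i p).[y] = 0.
  move=> yys; apply: contrapT => trans.
  pose i' : {rmorphism {poly A} -> B} :=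
    horner_morph (fun x : A => mulrC y (i x) : GRing.comm y (i x)).
  have i'C a : i' a%:P = i a by exact: horner_morphC.
  have i'X : i' 'X = y by exact: horner_morphX.
  have i'_inj : injective i'.
    apply: raddf_inj => p p0; apply/eqP; apply: contrapT => /negP pn0.
    by apply: trans; exists p.
  have [f' f'0 f'int] : exists2 f : {poly A}, f != 0 &
      forall b, exists k, integralOver i' (i' f ^+ k * b).
    apply: (IH _ _ i' (rem y ys)).
    - by rewrite size_rem // sys.
    - by [].
    - move=> b /iD[b' [a [a0 ba]]]; exists b', a%:P.
      by rewrite polyC_eq0 i'C.
    - move=> S SA SD SM Sy; apply: gen => // [a|z].
        by rewrite -i'C.
      rewrite (perm_mem (perm_to_rem yys)) inE => /orP[/eqP ->|]; last exact: Sy.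
      by rewrite -i'X.
  pose p : {poly A} := 1 + 'X * f'.
  have szp : (1 < size p)%N.
    have E : p = f' * 'X + 1 by rewrite /p addrC mulrC.
    by rewrite E size_polyDl size_mulX ?size_poly1 ?ltnS ?size_poly_gt0.
  have p0 : p != 0 by rewrite -size_poly_gt0 ltnW.
  have [|b' [a [a0 pba]]] := iD (i' p).
    by rewrite -(rmorph0 i') (inj_eq i'_inj).
  have [k kint] := f'int b'.
  have [|N [g pg]] := integral_quotient_dvd (p := p) (w := f' ^+ k * a%:P) i'_inj kint.
    by rewrite rmorphM rmorphXn i'C -pba mulrCA.
  (* Modulo p, X f' is -1. Hence multiplying p g = (f'^k a)^N by X^(kN) shows that p divides a^N up
     to sign. *)
  have pm1 M : exists h, ('X * f') ^+ M = p * h + (-1) ^+ M.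
    elim: M => [|M [h Eh]]; first by exists 0; rewrite mulr0 add0r !expr0.
    exists ('X * f' * h + (-1) ^+ M); rewrite [in LHS]exprS [in RHS]exprS Eh /p; ring.
  have [h Eh] := pm1 (k * N)%N.
  have : p * (g * 'X ^+ (k * N) - h * a%:P ^+ N) = ((-1) ^+ (k * N) * a ^+ N)%:P.
    rewrite mulrBr mulrA -pg exprMn -exprM polyCM !rmorphXn /= rmorphN1.
    move: Eh; rewrite exprMn => Eh.
    by rewrite mulrAC [_ * 'X ^+ _]mulrC Eh; ring.
  set G := g * _ - _ => pG.
  have c0 : (-1) ^+ (k * N) * a ^+ N != 0.
    by rewrite mulf_neq0 // expf_neq0 // oppr_eq0 oner_neq0.
  have G0 : G != 0.
    by apply: contra_neq c0 => G0; move: pG; rewrite G0 mulr0 => /esym/eqP;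
       rewrite polyC_eq0 => /eqP.
  have := congr1 (fun z : {poly A} => size z) pG; rewrite size_mul // size_polyC c0 /=.
  move: szp; rewrite -size_poly_gt0 in G0.
  by case: (size p) => [|[|u]] //; case: (size G) G0 => // l _ _; rewrite addnS.
(* All generators are now algebraic over A; f is the product of the leading coefficients of their
   equations. *)
have [f f0 fint] : exists2 f, f != 0 & forall y, y \in ys -> integralOver i (i f * y).
  elim: (ys) alg => [|y s IHs] alg; first by exists 1; rewrite ?oner_neq0.
  have [z zs|f f0 fint] := IHs; first by apply: alg; rewrite inE zs orbT.
  have [p p0 py] := alg y (mem_head _ _).
  exists (f * lead_coef p); first by rewrite mulf_neq0 ?lead_coef_eq0.
  move=> z; rewrite inE => /orP[/eqP ->|zs]; rewrite rmorphM.
    by rewrite -mulrA; apply: integral_mul; [exact: integral_id|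
      exact: algebraic_scaled_integral].
  by rewrite mulrAC; apply: integral_mul; [exact: fint|exact: integral_id].
exists f => //; have up k l b : integralOver i (i f ^+ k * b) -> (k <= l)%N ->
    integralOver i (i f ^+ l * b).
  move=> kb kl; rewrite -(subnK kl) exprD -mulrA; apply: integral_mul => //.
  by rewrite -rmorphXn; apply: integral_id.
apply: gen => [a|x y [k xk] [l yl]|x y [k xk] [l yl]|y yys].
- by exists 0; rewrite mul1r; apply: integral_id.
- exists (maxn k l); rewrite mulrDr; apply: integral_add.
    by apply: up xk _; rewrite leq_maxl.
  by apply: up yl _; rewrite leq_maxr.
- by exists (k + l)%N; rewrite exprD mulrACA; apply: integral_mul.
- by exists 1%N; rewrite expr1; apply: fint.
Qed.

(** R is divided by an ideal maximal among those missing the nonzero elements of L[c]; every nonzero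
    element of the quotient B then divides one of them. For the f given by [localization_integral],
    some f^k / (c - a) is integral over L[c], so X - a divides a power of f. *)
Lemma generic_nonunit (L : fieldType) (R : comNzRingType) (j : {rmorphism L -> R})
    (ys : seq R) (c : R) :
    generated j ys ->
    (forall p : {poly L}, p != 0 -> (map_poly j p).[c] <> 0) ->
  exists2 f : {poly L}, f != 0 & forall a u, u * (c - j a) = 1 -> f.[a] = 0.
Proof.
move=> gen trans.
pose iA : {rmorphism {poly L} -> R} :=
  horner_morph (fun x : L => mulrC c (j x) : GRing.comm c (j x)).
have iAC a : iA a%:P = j a by exact: horner_morphC.
have iAX : iA 'X = c by exact: horner_morphX.
have iA0 p : p != 0 -> iA p <> 0 by exact: trans.
pose avoid x := exists2 p, p != 0 & iA p = x.
have [||P [[P0 PD PM] Pav Pmax]] := @exists_maximal_stable R R *%R avoid.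
- exact: mulr0.
- by move=> [p /iA0].
have PidP : is_ideal P by split=> //; split.
have [|B [pr [pr_surj pr0]]] := exists_quotient PidP.
  by move=> P1; apply: (Pav _ P1); exists 1; rewrite ?oner_neq0 ?rmorph1.
pose i : {rmorphism {poly L} -> B} := pr \o iA.
have i_inj : injective i.
  apply: raddf_inj => p /pr0 Pp; apply/eqP; apply: contrapT => /negP p0.
  by apply: (Pav _ Pp); exists p.
have iD b : b != 0 -> exists b' a, a != 0 /\ b * b' = i a.
  have [x <-] := pr_surj b => x0.
  (* If no multiple of x became a nonzero polynomial in c, the ideal generated by P and x would
     still miss [avoid], against maximality. *)
  apply: contrapT => nob; move/eqP: x0; apply; apply/pr0.
  apply: (Pmax (fun z => exists y r, P y /\ z = y + r * x)).
  - split.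
    + by exists 0, 0; rewrite mul0r addr0.
    + move=> _ _ [y [r [Py ->]]] [z [s [Pz ->]]]; exists (y + z), (r + s).
      by split; [exact: PD|ring].
    + by move=> k _ [y [r [Py ->]]]; exists (k * y), (k * r); split; [exact: PM|ring].
  - by move=> z Pz; exists z, 0; rewrite mul0r addr0.
  - move=> _ [y [r [Py ->]]] [p p0 /(congr1 pr)].
    rewrite rmorphD (pr0 y).2 // add0r rmorphM mulrC => E.
    by apply: nob; exists (pr r), p.
  - by exists 0, 1; rewrite mul1r add0r.
have [|f f0 fint] := localization_integral (ys := map pr ys) i_inj iD.
  move=> S SA SD SM Sy b; have [x <-] := pr_surj b.
  apply: (gen (fun x => S (pr x))) => [a|y z|y z|y yys].
  - by rewrite -iAC; exact: SA.
  - by rewrite rmorphD; exact: SD.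
  - by rewrite rmorphM; exact: SM.
  - by apply: Sy; apply: map_f.
exists f => // a u ua.
have [k kint] := fint (pr u).
have [|N [g fg]] := integral_quotient_dvd (p := 'X - a%:P) (w := f ^+ k) i_inj kint.
  rewrite [RHS]rmorphXn mulrCA; rewrite /i /= -rmorphM rmorphB /= iAX iAC.
  by rewrite [_ * u]mulrC ua rmorph1 mulr1.
have := congr1 (horner^~ a) fg; rewrite -exprM hornerM hornerXsubC subrr mul0r horner_exp.
by move/eqP; rewrite expf_eq0 => /andP[_ /eqP].
Qed.

(** * Gaussian binomials *)

(** The q-Pascal rule defines Gaussian binomials over any semiring without division. Identities that
    need division by q-factorials are proved at q = x in Z[x] and specialised by [int_horner]. *)
Fixpoint qbin (R : pzSemiRingType) (q : R) (r k : nat) : R :=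
  match r, k with
  | _, 0 => 1
  | 0, _.+1 => 0
  | r'.+1, k'.+1 => q ^+ k * qbin q r' k + qbin q r' k'
  end.

Lemma qbin0 (R : pzSemiRingType) (q : R) r : qbin q r 0 = 1.
Proof. by case: r. Qed.

Lemma qbinS (R : pzSemiRingType) (q : R) r k :
  qbin q r.+1 k.+1 = q ^+ k.+1 * qbin q r k.+1 + qbin q r k.
Proof. by []. Qed.

Lemma rmorph_qbin (R S : pzSemiRingType) (f : {rmorphism R -> S}) (q : R) r k :
  f (qbin q r k) = qbin (f q) r k.
Proof.
elim: r k => [|r IH] [|k] /=; rewrite ?rmorph0 ?rmorph1 //.
by rewrite rmorphD rmorphM rmorphXn -!IH.
Qed.

Lemma qbin_small (R : pzSemiRingType) (q : R) r k : (r < k)%N -> qbin q r k = 0.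
Proof.
elim: r k => [|r IH] [|k] //= rk.
by rewrite !IH ?mulr0 ?addr0 // ltnW.
Qed.

Lemma qbin1 (R : comPzRingType) (q : R) r : (q - 1) * qbin q r 1 = q ^+ r - 1.
Proof.
elim: r => [|r IH]; first by rewrite expr0 subrr mulr0.
by rewrite qbinS mulrDr qbin0 mulrCA IH !expr1 exprS; ring.
Qed.

Definition qfact (R : pzRingType) (q : R) (k : nat) : R := \prod_(i < k) (1 - q ^+ i.+1).

Lemma qfactS (R : pzRingType) (q : R) k : qfact q k.+1 = qfact q k * (1 - q ^+ k.+1).
Proof. by rewrite /qfact big_ord_recr. Qed.

(** Double induction by the q-Pascal rule and 1 - q^(a+b) = q^a (1 - q^b) + (1 - q^a). *)
Lemma qbin_qfact (R : comPzRingType) (q : R) a b :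
  qbin q (a + b) a * qfact q a * qfact q b = qfact q (a + b).
Proof.
have q0 : qfact q 0 = 1 by rewrite /qfact big_ord0.
elim: a b => [|a IHa] b; first by rewrite qbin0 q0 !mul1r.
elim: b => [|b IHb].
  rewrite addn0; have := IHa 0%N; rewrite addn0 q0 !mulr1 => IH.
  by rewrite qbinS qbin_small // mulr0 add0r !qfactS mulrA IH.
have := IHa b.+1; move: IHb; rewrite !addSn !addnS [qbin q (a + b).+2 _]qbinS.
rewrite [qfact q (a + b).+2]qfactS [qfact q b.+1]qfactS [qfact q a.+1]qfactS => E1 E2.
have -> : q ^+ (a + b).+2 = q ^+ a.+1 * q ^+ b.+1 by rewrite -exprD addSn addnS.
transitivity (q ^+ a.+1 * (1 - q ^+ b.+1) * qfact q (a + b).+1 +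
  (1 - q ^+ a.+1) * qfact q (a + b).+1); last by ring.
by rewrite -{1}E1 -E2; ring.
Qed.

Lemma qfact_generic_neq0 k : qfact ('X : {poly int}) k != 0.
Proof.
apply/prodf_neq0 => i _; rewrite subr_eq0.
by apply/eqP => /(congr1 (fun p : {poly int} => size p)); rewrite size_poly1 size_polyXn.
Qed.

Definition int_horner (R : comNzRingType) (q : R) : {rmorphism {poly int} -> R} :=
  horner_morph (fun z : int => mulrC q z%:~R : GRing.comm q z%:~R).

Lemma int_hornerX (R : comNzRingType) (q : R) : int_horner q 'X = q.
Proof. exact: horner_morphX. Qed.

Lemma qbin_sym (R : comNzRingType) (q : R) a b : qbin q (a + b) a = qbin q (b + a) b.
Proof.
rewrite -(int_hornerX q) -!rmorph_qbin; congr (int_horner q _).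
apply: (mulIf (qfact_generic_neq0 a)); apply: (mulIf (qfact_generic_neq0 b)).
by rewrite qbin_qfact mulrAC qbin_qfact addnC.
Qed.

(** Both sides are the q-multinomial coefficient of a + i + j with parts a, i, j. *)
Lemma qbin_trinomial (R : comNzRingType) (q : R) a i j :
  qbin q (a + i) i * qbin q (a + i + j) j = qbin q (i + j) i * qbin q (a + i + j) (i + j).
Proof.
rewrite -(int_hornerX q) -!rmorph_qbin -!rmorphM; congr (int_horner q _).
have nz := qfact_generic_neq0.
apply: (mulIf (nz a)); apply: (mulIf (nz i)); apply: (mulIf (nz j)).
apply: (mulIf (nz (a + i)%N)); apply: (mulIf (nz (i + j)%N)).
have key (S : comNzRingType) (g1 g2 g3 g4 fa fi fj fai fij faij : S) :
    g1 * fi * fa = fai -> g2 * fj * fai = faij -> g3 * fi * fj = fij ->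
    g4 * fij * fa = faij ->
    g1 * g2 * fa * fi * fj * fai * fij = g3 * g4 * fa * fi * fj * fai * fij.
  move=> E1 E2 E3 E4; transitivity ((g1 * fi * fa) * (g2 * fj * fai) * fij).
    ring.
  by rewrite E1 E2 -{1}E4 -{1}E3; ring.
apply: (key _ _ _ _ _ _ _ _ _ _ (qfact 'X (a + i + j))).
- by rewrite [in LHS]addnC qbin_qfact addnC.
- by rewrite [in LHS]addnC qbin_qfact addnC.
- exact: qbin_qfact.
- by rewrite -addnA addnC qbin_qfact.
Qed.

Lemma qbinomE (C : closedFieldType) (q : C) r k : qbinom q r k = qbin q r k.
Proof.
rewrite /qbinom; transitivity (int_horner q (qbinom_poly r k)); first by [].
rewrite -{2}(int_hornerX q) -rmorph_qbin; congr (int_horner q _).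
have lc m : lead_coef (qfact ('X : {poly int}) m) \is a GRing.unit.
  rewrite lead_coef_prod rpred_prod // => i _.
  rewrite -unitrN -lead_coefN opprB lead_coefDl ?lead_coefXn ?unitr1 //.
  by rewrite size_polyN size_poly1 size_polyXn.
rewrite /qbinom_poly -/(qfact _ k).
have -> : \prod_(i < k) (1 - 'X^(r - i)) = qbin 'X r k * qfact ('X : {poly int}) k.
  have [kr|rk] := leqP k r; last first.
    (* For k > r the factor of index r is 1 - x^0 = 0. *)
    rewrite qbin_small // mul0r (bigD1 (Ordinal rk)) //= subnn expr0 subrr mul0r.
    by [].
  apply: (mulIf (qfact_generic_neq0 (r - k)%N)).
  have := qbin_qfact ('X : {poly int}) k (r - k); rewrite subnKC // => ->.
  rewrite /qfact -(big_mkord xpredT (fun i => 1 - 'X^(r - i))).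
  rewrite -!(big_mkord xpredT (fun i => 1 - 'X^(i.+1))) /=.
  rewrite (@big_cat_nat _ _ _ (r - k)%N 0 r) ?leq_subr //= mulrC; congr (_ * _).
  rewrite big_nat_rev add0n big_nat -[in RHS](add0n (r - k)%N) big_addn subKn //.
  by rewrite [in RHS]big_nat; apply: eq_bigr => i ik; congr (1 - 'X^_); lia.
by rewrite Pdiv.IdomainUnit.mulpK.
Qed.

(** * q-divided differences of polynomials *)

Section QDifferencePolynomials.
Variables (R : comNzRingType) (q : R).
Implicit Types p r : {poly R}.

(** The operator x^m |-> binom(m, k)_q x^(m-k); [size p] is only a safe bound on the degree. *)
Definition qdiff (k : nat) (p : {poly R}) : {poly R} :=
  \poly_(i < size p) (qbin q (i + k) k * p`_(i + k)).

Definition qscale : {poly R} -> {poly R} := comp_poly (q *: 'X).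

Lemma coef_qdiff k p i : (qdiff k p)`_i = qbin q (i + k) k * p`_(i + k).
Proof.
rewrite coef_poly; case: ltnP => // le; rewrite [p`_ _]nth_default ?mulr0 //.
by rewrite (leq_trans le) // leq_addr.
Qed.

Lemma qdiff0 p : qdiff 0 p = p.
Proof. by apply/polyP => i; rewrite coef_qdiff addn0 qbin0 mul1r. Qed.

Lemma qdiffD k p r : qdiff k (p + r) = qdiff k p + qdiff k r.
Proof. by apply/polyP => i; rewrite coefD !coef_qdiff coefD mulrDr. Qed.

Lemma qdiff_0 k : qdiff k 0 = 0.
Proof. by apply/polyP => i; rewrite coef_qdiff !coef0 mulr0. Qed.

Lemma qdiffCM k c p : qdiff k (c%:P * p) = c%:P * qdiff k p.
Proof. by apply/polyP => i; rewrite coefCM !coef_qdiff coefCM mulrCA. Qed.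

Lemma qdiffC k c : qdiff k.+1 c%:P = 0.
Proof. by apply/polyP => i; rewrite coef_qdiff coef0 coefC addnS mulr0. Qed.

Lemma qdiffXM k p :
  qdiff k ('X * p) = (q ^+ k)%:P * ('X * qdiff k p) + (if k is k'.+1 then qdiff k' p else 0).
Proof.
apply/polyP => i; rewrite coefD coefCM !coefXM !coef_qdiff coefXM.
case: k => [|k]; first by rewrite !addn0 coef0 addr0 expr0 !qbin0 !mul1r.
rewrite coef_qdiff addnS /=; case: i => [|i] /=.
  by rewrite mulr0 add0r add0n qbin_small // mulr0 add0r.
by rewrite !addSn !addnS mulrA -mulrDl -qbinS.
Qed.

Lemma qdiff_comp i j p : qdiff i (qdiff j p) = (qbin q (i + j) i)%:P * qdiff (i + j) p.
Proof.
apply/polyP => a; rewrite coefCM !coef_qdiff !addnA !mulrA; congr (_ * _).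
exact: qbin_trinomial.
Qed.

Lemma qscaleX : qscale 'X = q%:P * 'X.
Proof. by rewrite /qscale comp_polyX mul_polyC. Qed.

Lemma iter_qscaleD i p r : iter i qscale (p + r) = iter i qscale p + iter i qscale r.
Proof. by elim: i => //= i ->; rewrite /qscale rmorphD. Qed.

Lemma iter_qscaleM i p r : iter i qscale (p * r) = iter i qscale p * iter i qscale r.
Proof. by elim: i => //= i ->; rewrite /qscale rmorphM. Qed.

Lemma iter_qscaleC i c : iter i qscale c%:P = c%:P.
Proof. by elim: i => //= i ->; rewrite /qscale comp_polyC. Qed.

Lemma iter_qscaleX i : iter i qscale 'X = (q ^+ i)%:P * 'X.
Proof.
elim: i => [|i IH] /=; first by rewrite expr0 mul1r.
by rewrite IH /qscale rmorphM /= comp_polyC -/qscale qscaleX mulrA -polyCM exprSr.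
Qed.

Lemma qdiffM k p r :
  qdiff k (p * r) = \sum_(i < k.+1) iter i qscale (qdiff (k - i) p) * qdiff i r.
Proof.
elim/poly_ind: p k => [|p c IH] k.
  rewrite mul0r big1 => [|i _].
    by rewrite qdiff_0.
  by rewrite qdiff_0 (iter_qscaleC _ 0) mul0r.
rewrite mulrDl qdiffD; under eq_bigr do rewrite qdiffD iter_qscaleD mulrDl.
rewrite big_split /=; congr (_ + _); last first.
  rewrite qdiffCM big_ord_recr /= subnn qdiff0 iter_qscaleC big1 ?add0r // => i _.
  by rewrite -(subnSK (ltn_ord i)) qdiffC (iter_qscaleC _ 0) mul0r.
have -> : p * 'X * r = 'X * (p * r) by rewrite mulrAC mulrC.
rewrite qdiffXM.
(* The factor q^(k-i) of [qdiffXM] and the factor q^i of the i-th shift of X combine to q^k for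
   every i, so the first parts sum to a multiple of the induction hypothesis for k, and the second
   parts to the one for k - 1. *)
have E (i : 'I_k.+1) : iter i qscale (qdiff (k - i) (p * 'X)) * qdiff i r =
    (q ^+ k)%:P * 'X * (iter i qscale (qdiff (k - i) p) * qdiff i r) +
    iter i qscale (if (k - i)%N is j.+1 then qdiff j p else 0) * qdiff i r.
  rewrite [p * _]mulrC qdiffXM iter_qscaleD !iter_qscaleM iter_qscaleC iter_qscaleX.
  rewrite mulrDl; congr (_ + _); rewrite !mulrA -polyCM -exprD subnK //.
  by rewrite -ltnS.
rewrite (eq_bigr _ (fun i _ => E i)) big_split /= -mulr_sumr -IH mulrA; congr (_ + _).
rewrite big_ord_recr /= subnn (iter_qscaleC _ 0) mul0r addr0.
case: k {E} => [|k]; first by rewrite big_ord0.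
rewrite IH; apply: eq_bigr => i _.
by rewrite subSn // -ltnS.
Qed.

Lemma qscale_qdiff p : qscale p = p + (q - 1)%:P * ('X * qdiff 1 p).
Proof.
elim/poly_ind: p => [|p c IH].
  by rewrite qdiff_0 /qscale rmorph0 !mulr0 addr0.
have E : qscale (p * 'X + c%:P) = qscale p * qscale 'X + c%:P.
  by rewrite /qscale rmorphD rmorphM /= comp_polyC.
rewrite E qdiffD qdiffC addr0 [p * 'X]mulrC qdiffXM qdiff0 expr1 qscaleX IH polyCB polyC1.
ring.
Qed.

Lemma iter_qscale_id n p : q ^+ n = 1 -> iter n qscale p = p.
Proof.
move=> qn; have E i : iter i qscale p = p \Po ((q ^+ i)%:P * 'X).
  elim: i => [|i IH] /=; first by rewrite expr0 mul1r comp_polyXr.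
  rewrite IH /qscale -comp_polyA; congr comp_poly.
  by rewrite rmorphM /= comp_polyC comp_polyX -mul_polyC mulrA -polyCM exprSr.
by rewrite E qn mul1r comp_polyXr.
Qed.

End QDifferencePolynomials.

(** * The ring of q-Taylor series *)

(* [f : qtaylor q t] stands for the q-Taylor series
   sum_k f_k (x - t)(x - q t)...(x - q^(k-1) t), i.e. for an element of the
   completion of [R[x]] along the points t, q t, q^2 t, ... *)
Definition qtaylor (R : comNzRingType) (q t : R) : Type := nat -> R.

Section QTaylor.
Variables (R : comNzRingType) (q t : R).
Local Notation W := (qtaylor q t).
Implicit Types (f g h : W) (p r : {poly R}).

HB.instance Definition _ := gen_eqMixin W.
HB.instance Definition _ := gen_choiceMixin W.

(** The k-th coefficient is the value of delta^(k) at t, so this is the rule delta^(k) delta^(i) =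
    binom(k+i, k)_q delta^(k+i) read at t. *)
Definition tdiff (i : nat) (f : W) : W := fun k => qbin q (k + i) k * f (k + i)%N.

(** Multiplication by x: with N_k = (x - t) ... (x - q^(k-1) t), one has x N_k = N_(k+1) + q^k t
    N_k. *)
Definition txmul (f : W) : W :=
  fun k => q ^+ k * t * f k + (if k is k'.+1 then f k' else 0).

Definition tshift (f : W) : W := fun k => f k + (q - 1) * txmul (tdiff 1 f) k.

(** The skew Leibniz rule evaluated at t, coefficient 0 of a series being its value at t. *)
Definition tmul (f g : W) : W :=
  fun k => \sum_(i < k.+1) iter i tshift (tdiff (k - i) f) 0%N * g i.

Definition tconst (c : R) : W := fun k => if k is 0 then c else 0.

Definition tpoly (p : {poly R}) : W := fun k => (qdiff q k p).[t].

Definition agree (N : nat) (f g : W) : Prop := forall k, (k < N)%N -> f k = g k.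

Lemma agree_le M N f g : (M <= N)%N -> agree N f g -> agree M f g.
Proof. by move=> MN fg k kM; apply: fg; apply: leq_trans MN. Qed.

Lemma agree_tdiff N i f g : agree (N + i) f g -> agree N (tdiff i f) (tdiff i g).
Proof. by move=> fg k kN; rewrite /tdiff fg // ltn_add2r. Qed.

Lemma agree_tshift N f g : agree N.+1 f g -> agree N (tshift f) (tshift g).
Proof.
move=> fg k kN; rewrite /tshift /txmul /tdiff.
rewrite (fg k) ?(fg (k + 1)%N) ?addn1 ?ltnS //; last exact: ltnW.
by case: k kN => // k kN; rewrite (fg (k + 1)%N) // addn1 ltnW.
Qed.

Lemma agree_iter_tshift i N f g :
  agree (N + i) f g -> agree N (iter i tshift f) (iter i tshift g).
Proof.
elim: i N => [|i IH] N fg /=; first by rewrite addn0 in fg.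
by apply: agree_tshift; apply: IH; rewrite addSnnS.
Qed.

(** No precision is lost: in coefficient k the i-th shift costs i coefficients of f and
    [tdiff (k - i)] costs k - i, so f is used only up to index k. *)
Lemma agree_tmul N f f' g g' :
  agree N f f' -> agree N g g' -> agree N (tmul f g) (tmul f' g').
Proof.
move=> ff' gg' k kN; apply: eq_bigr => i _.
have ik : (i <= k)%N by rewrite -ltnS.
rewrite gg'; last exact: leq_ltn_trans kN.
congr (_ * _); apply: (agree_iter_tshift (N := 1)) => //.
by apply: agree_tdiff; apply: agree_le ff'; rewrite add1n addSn subnKC.
Qed.

Lemma tpolyD p r k : tpoly (p + r) k = tpoly p k + tpoly r k.
Proof. by rewrite /tpoly qdiffD hornerD. Qed.

Lemma tpolyCM c p k : tpoly (c%:P * p) k = c * tpoly p k.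
Proof. by rewrite /tpoly qdiffCM hornerCM. Qed.

Lemma tpolyC c : tpoly c%:P = tconst c.
Proof.
by apply/funext => -[|k]; rewrite /tpoly ?qdiff0 ?qdiffC ?horner0 ?hornerC.
Qed.

Lemma tpoly_qdiff i p : tpoly (qdiff q i p) = tdiff i (tpoly p).
Proof. by apply/funext => k; rewrite /tpoly qdiff_comp hornerCM. Qed.

Lemma tpolyXM p : tpoly ('X * p) = txmul (tpoly p).
Proof.
apply/funext => k; rewrite /tpoly qdiffXM hornerD hornerCM hornerM hornerX mulrA.
by case: k => //; rewrite horner0.
Qed.

Lemma tpoly_qscale p : tpoly (qscale q p) = tshift (tpoly p).
Proof.
apply/funext => k; rewrite qscale_qdiff tpolyD tpolyCM tpolyXM tpoly_qdiff.
by [].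
Qed.

Lemma tpoly_iter_qscale i p : tpoly (iter i (qscale q) p) = iter i tshift (tpoly p).
Proof. by elim: i => //= i IH; rewrite tpoly_qscale IH. Qed.

Lemma tpolyM p r : tpoly (p * r) = tmul (tpoly p) (tpoly r).
Proof.
apply/funext => k; rewrite {1}/tpoly qdiffM horner_sum; apply: eq_bigr => i _.
rewrite hornerM; congr (_ * _).
by rewrite -tpoly_qdiff -tpoly_iter_qscale /tpoly qdiff0.
Qed.

(** Newton interpolation: the k-th coefficient of the Newton polynomial N_M is 1 if k = M and 0
    otherwise. With the [agree] lemmas this carries identities from R[x] to W. *)
Lemma tpoly_dense N f : exists p, agree N f (tpoly p).
Proof.
pose nw M : {poly R} := \prod_(i < M) ('X - (q ^+ i * t)%:P).
have nwE M k : tpoly (nw M) k = (k == M)%:R.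
  elim: M k => [|M IH] k.
    by rewrite /nw big_ord0 -polyC1 tpolyC; case: k.
  have -> : nw M.+1 = 'X * nw M + (- (q ^+ M * t))%:P * nw M.
    by rewrite /nw big_ord_recr /= polyCN; ring.
  rewrite tpolyD tpolyCM tpolyXM /txmul IH.
  have -> : (if k is k'.+1 then tpoly (nw M) k' else 0) = (k == M.+1)%:R.
    by case: k => // k; rewrite IH.
  by have [->|_] := eqVneq k M; rewrite /= ?mulr1 ?mulr0; ring.
elim: N => [|N [p fp]]; first by exists 0.
exists (p + (f N - tpoly p N)%:P * nw N) => k.
rewrite ltnS leq_eqVlt => /orP[/eqP ->|kN]; rewrite tpolyD tpolyCM nwE.
  by rewrite eqxx mulr1 addrC subrK.
by rewrite fp // ltn_eqF // mulr0 addr0.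
Qed.

Lemma tmul_tpoly N f g p r : agree N f (tpoly p) -> agree N g (tpoly r) ->
  agree N (tmul f g) (tpoly (p * r)).
Proof. by move=> fp gr; rewrite tpolyM; apply: agree_tmul. Qed.

Lemma agree_sym N f g : agree N f g -> agree N g f.
Proof. by move=> fg k kN; rewrite fg. Qed.

Lemma agree_trans N f g h : agree N f g -> agree N g h -> agree N f h.
Proof. by move=> fg gh k kN; rewrite fg // gh. Qed.

Lemma agree_eq f g : (forall N, agree N f g) -> f = g.
Proof. by move=> fg; apply/funext => k; apply: (fg k.+1). Qed.

Definition tadd (f g : W) : W := fun k => f k + g k.
Definition topp (f : W) : W := fun k => - f k.

Lemma taddA : associative tadd.
Proof. by move=> f g h; apply/funext => k; apply: addrA. Qed.
Lemma taddC : commutative tadd.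
Proof. by move=> f g; apply/funext => k; apply: addrC. Qed.
Lemma tadd0 : left_id (tconst 0) tadd.
Proof. by move=> f; apply/funext => -[|k]; apply: add0r. Qed.
Lemma taddN : left_inverse (tconst 0) topp tadd.
Proof. by move=> f; apply/funext => -[|k]; apply: addNr. Qed.

HB.instance Definition _ := GRing.isZmodule.Build W taddA taddC tadd0 taddN.

Lemma tpoly_add p r : tpoly (p + r) = tpoly p + tpoly r :> W.
Proof. by apply/funext => k; rewrite tpolyD. Qed.

Lemma tmulA : associative tmul.
Proof.
move=> f g h; apply: agree_eq => N.
have [p fp] := tpoly_dense N f; have [r gr] := tpoly_dense N g.
have [u hu] := tpoly_dense N h.
have E1 := tmul_tpoly fp (tmul_tpoly gr hu).
have := tmul_tpoly (tmul_tpoly fp gr) hu; rewrite -mulrA.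
by move=> /agree_sym; apply: agree_trans.
Qed.

Lemma tmulC : commutative tmul.
Proof.
move=> f g; apply: agree_eq => N.
have [p fp] := tpoly_dense N f; have [r gr] := tpoly_dense N g.
apply: agree_trans (tmul_tpoly fp gr) _.
by rewrite mulrC; apply: agree_sym; apply: tmul_tpoly.
Qed.

Lemma tmulDl : left_distributive tmul tadd.
Proof.
move=> f g h; rewrite tmulC [tmul f h]tmulC [tmul g h]tmulC.
apply/funext => k; rewrite /tmul /tadd -big_split /=.
by apply: eq_bigr => i _; rewrite mulrDr.
Qed.

Lemma tmul1 : left_id (tconst 1) tmul.
Proof.
move=> f; rewrite tmulC; apply/funext => k; rewrite /tmul.
rewrite big_ord_recl big1 ?addr0 /= => [|i _]; last by rewrite mulr0.
by rewrite mulr1 subn0 /tdiff add0n qbin0 mul1r.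
Qed.

Lemma tone_neq0 : tconst 1 != 0 :> W.
Proof.
by apply/eqP => /(congr1 (fun f : W => f 0%N)) /eqP; rewrite (negbTE (oner_neq0 R)).
Qed.
HB.instance Definition _ :=
  GRing.Zmodule_isComNzRing.Build W tmulA tmulC tmul1 tmulDl tone_neq0.

Lemma taddE f g k : (f + g) k = f k + g k.
Proof. by []. Qed.

Lemma tmulE f g k :
  (f * g) k = \sum_(i < k.+1) iter i tshift (tdiff (k - i) f) 0%N * g i.
Proof. by []. Qed.

Lemma tsumE (I : Type) (s : seq I) (P : pred I) (F : I -> W) k :
  (\sum_(i <- s | P i) F i) k = \sum_(i <- s | P i) F i k.
Proof.
elim/big_rec2: _ => [|i y z _ <-]; last by rewrite taddE.
by case: k.
Qed.

Lemma tpoly_mul p r : tpoly (p * r) = tpoly p * tpoly r.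
Proof. exact: tpolyM. Qed.

Lemma tconstM c f k : (tconst c * f) k = c * f k.
Proof.
rewrite mulrC tmulE big_ord_recl big1 ?addr0 /= => [|i _]; last by rewrite mulr0.
by rewrite subn0 /tdiff add0n qbin0 mul1r mulrC.
Qed.

Lemma txmulE f : txmul f = tpoly 'X * f.
Proof.
apply: agree_eq => N; have [p fp] := tpoly_dense N f.
have E : agree N (txmul f) (txmul (tpoly p)).
  by move=> k kN; rewrite /txmul fp //; case: k kN => // k kN; rewrite fp // ltnW.
apply: agree_trans E _; rewrite -tpolyXM; apply: agree_sym.
by apply: (@tmul_tpoly N).
Qed.

Lemma tshiftE f : tshift f = f + tconst (q - 1) * (tpoly 'X * tdiff 1 f).
Proof. by apply/funext => k; rewrite taddE tconstM -txmulE. Qed.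

Lemma tdiffD i f g : tdiff i (f + g) = tdiff i f + tdiff i g.
Proof. by apply/funext => k; rewrite taddE /tdiff taddE mulrDr. Qed.

Lemma tshiftD f g : tshift (f + g) = tshift f + tshift g.
Proof. by rewrite !tshiftE tdiffD; ring. Qed.

Lemma tshiftM f g : tshift (f * g) = tshift f * tshift g.
Proof.
apply: agree_eq => N; have [p fp] := tpoly_dense N.+1 f.
have [r gr] := tpoly_dense N.+1 g.
apply: agree_trans (agree_tshift (tmul_tpoly fp gr)) _.
rewrite -tpoly_qscale /qscale rmorphM -/(qscale q) tpoly_mul !tpoly_qscale.
by apply: agree_sym; apply: agree_tmul; apply: agree_tshift.
Qed.

Lemma tshift_const c : tshift (tconst c) = tconst c.
Proof. by rewrite -tpolyC -tpoly_qscale /qscale comp_polyC. Qed.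

Lemma tdiff0 f : tdiff 0 f = f.
Proof. by apply/funext => k; rewrite /tdiff addn0 -[k in qbin q k]addn0 qbin_sym qbin0 mul1r. Qed.

Lemma tdiff_comp i j f : tdiff i (tdiff j f) = tconst (qbin q (i + j) i) * tdiff (i + j) f.
Proof.
apply: agree_eq => N; have [p fp] := tpoly_dense (N + i + j) f.
apply: (@agree_trans _ _ (tdiff i (tdiff j (tpoly p)))).
  by do 2!apply: agree_tdiff.
rewrite -!tpoly_qdiff qdiff_comp tpoly_mul tpolyC tpoly_qdiff.
apply: agree_sym; apply: agree_tmul => //.
by apply: agree_tdiff; rewrite addnA.
Qed.

Lemma tdiffM k f g :
  tdiff k (f * g) = \sum_(i < k.+1) iter i tshift (tdiff (k - i) f) * tdiff i g.
Proof.
apply: agree_eq => N; have [p fp] := tpoly_dense (N + k) f.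
have [r gr] := tpoly_dense (N + k) g.
apply: agree_trans (agree_tdiff (tmul_tpoly fp gr)) _.
rewrite -tpoly_qdiff qdiffM => m mN.
have t0 : tpoly 0 = 0 by rewrite -(polyC0 R) tpolyC.
rewrite (big_morph tpoly tpoly_add t0) !tsumE; apply: eq_bigr => i _.
have ik : (i <= k)%N by rewrite -ltnS.
rewrite tpoly_mul tpoly_iter_qscale !tpoly_qdiff.
apply: (agree_tmul (N := N)) => //; apply: agree_sym; last first.
  by apply: agree_tdiff; apply: agree_le gr; rewrite leq_add2l.
apply: agree_iter_tshift; apply: agree_tdiff; apply: agree_le fp.
by rewrite -addnA subnKC.
Qed.

Lemma iter_tshift_id n f : q ^+ n = 1 -> iter n tshift f = f.
Proof.
move=> qn; apply: agree_eq => N; have [p fp] := tpoly_dense (N + n) f.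
apply: agree_trans (agree_iter_tshift fp) _.
rewrite -tpoly_iter_qscale iter_qscale_id //; apply: agree_sym.
by apply: agree_le fp; apply: leq_addr.
Qed.

(** The hypothesis says that the values of f at the points q^i t are units. They are the diagonal of
    the triangular system f g = 1 for the coefficients of g; [gs k] lists the first k of these. *)
Lemma tunit f : (forall i, exists u, iter i tshift f 0%N * u = 1) ->
  exists g : W, f * g = 1.
Proof.
move=> /choice[v fv].
pose c k i := iter i tshift (tdiff (k - i) f) 0%N.
pose gs := fix gs k := if k is k'.+1 then
  rcons (gs k') (v k' * ((k' == 0%N)%:R - \sum_(i < k') c k' i * (gs k')`_i)) else [::].
have sz k : size (gs k) = k by elim: k => //= k IH; rewrite size_rcons IH.
pose g : W := fun k => (gs k.+1)`_k.
have gE m i : (i < m)%N -> (gs m)`_i = g i.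
  elim: m => // m IH; rewrite ltnS leq_eqVlt => /orP[/eqP -> //|im].
  by rewrite /= nth_rcons sz im IH.
exists g; apply/funext => k; rewrite tmulE big_ord_recr /= subnn tdiff0.
rewrite {2}/g /= nth_rcons sz ltnn eqxx mulrA fv mul1r.
have -> : \sum_(i < k) c k i * (gs k)`_i = \sum_(i < k) c k i * g i.
  by apply: eq_bigr => i _; rewrite gE.
by rewrite addrC subrK; case: k.
Qed.

End QTaylor.

(** * Iterative q-difference rings *)

Lemma sigmaF_tofrac (C : closedFieldType) (q : C) (p : {poly C}) :
  q != 0 -> sigmaF q (tofrac p) = tofrac (p \Po (q *: 'X)).
Proof.
move=> q0; rewrite /sigmaF; set r := repr _.
have E : \n_r = p * \d_r.
  have := FracField.equivf_l (Ratio p 1); rewrite /r.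
  have -> : (\pi_(FracField.type {poly C}) (Ratio p 1))%qT = tofrac p.
    by rewrite piE.
  by rewrite !numden_Ratio ?oner_neq0 // mulr1 mulrC.
have d0 : (\d_r) \Po (q *: 'X) != 0.
  rewrite comp_poly2_eq0 ?denom_ratioP // size_scale // size_polyX //.
rewrite E comp_polyM tofracM mulfK // tofrac_eq0 //.
Qed.

Lemma sigmaF_cF (C : closedFieldType) (q c : C) : q != 0 -> sigmaF q (cF c) = cF c.
Proof. by move=> q0; rewrite /cF sigmaF_tofrac // comp_polyC. Qed.

Lemma sigmaF_tF (C : closedFieldType) (q : C) : q != 0 -> sigmaF q (tF C) = cF q * tF C.
Proof. by move=> q0; rewrite /tF /cF sigmaF_tofrac // comp_polyX -mul_polyC tofracM. Qed.

Definition cF_morph (C : closedFieldType) : {rmorphism C -> Ct C} :=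
  @tofrac {poly C} \o polyC.

Lemma cF_morphE (C : closedFieldType) (c : C) : cF c = cF_morph C c.
Proof. by []. Qed.

Lemma tF_neq0 (C : closedFieldType) : tF C != 0.
Proof. by rewrite /tF tofrac_eq0 polyX_eq0. Qed.

Lemma cF_eq0 (C : closedFieldType) (c : C) : (cF c == 0) = (c == 0).
Proof. by rewrite cF_morphE fmorph_eq0. Qed.

(* Otherwise unification unfolds the quotient construction of C(t). *)
Local Opaque tF cF.

Section IDqRingTheory.
Variables (C : closedFieldType) (n : nat) (q : C).
Hypotheses (n_gt1 : (2 <= n)%N) (q_prim : n.-primitive_root q).
Variables (R : comNzRingType) (iF : {rmorphism Ct C -> R}) (s : R -> R) (d : nat -> R -> R).
Hypothesis HR : IDq_ring q iF s d.

Let sD : forall a b, s (a + b) = s a + s b. Proof. by case: HR. Qed.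
Let sM : forall a b, s (a * b) = s a * s b. Proof. by case: HR => _ []. Qed.
Let s1 : s 1 = 1. Proof. by case: HR => _ [_ []]. Qed.
Let siF : forall f, s (iF f) = iF (sigmaF q f).
Proof. by case: HR => _ [_ [_ [_ []]]]. Qed.
Let d0 : forall a, d 0 a = a. Proof. by case: HR => _ [_ [_ [_ [_ []]]]]. Qed.
Let d1 : forall a, d 1 a = (s a - a) * iF (((cF (q - 1)) * tF C)^-1).
Proof. by case: HR => _ [_ [_ [_ [_ [_ []]]]]]. Qed.
Let dD : forall k a b, d k (a + b) = d k a + d k b.
Proof. by case: HR => _ [_ [_ [_ [_ [_ [_ []]]]]]]. Qed.
Let dM : forall k a b, d k (a * b) = \sum_(i < k.+1) iter i s (d (k - i)%N a) * d i b.
Proof. by case: HR => _ [_ [_ [_ [_ [_ [_ [_ []]]]]]]]. Qed.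
Let dd i j a : d i (d j a) = iF (cF (qbin q (i + j) i)) * d (i + j)%N a.
Proof. by rewrite -qbinomE; case: HR => _ [_ [_ [_ [_ [_ [_ [_ []]]]]]]]. Qed.

Lemma IDq_q_neq0 : q != 0.
Proof.
apply/eqP => q0; have /eqP := prim_expr_order q_prim.
by rewrite q0 expr0n gtn_eqF ?(ltnW n_gt1) // eq_sym oner_eq0.
Qed.

Lemma IDq_q_neq1 : q - 1 != 0.
Proof.
rewrite subr_eq0; apply/eqP => q1; have := prim_order_dvd q_prim 1.
by rewrite expr1 q1 eqxx dvdn1 => /eqP n1; move: n_gt1; rewrite n1.
Qed.

Lemma IDq_n_neq0 : n%:R != 0 :> C.
Proof. by rewrite natf_neq0_pchar (pchar_prim_root q_prim). Qed.

Lemma cFtF_neq0 : cF (q - 1) * tF C != 0.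
Proof. by apply: mulf_neq0; [rewrite cF_eq0; exact: IDq_q_neq1|exact: tF_neq0]. Qed.

Lemma iF_cancel (f : Ct C) x : f != 0 -> iF f * x = 0 -> x = 0.
Proof.
by move=> f0 fx; rewrite -[x]mul1r -(rmorph1 iF) -(mulVf f0) rmorphM -mulrA fx mulr0.
Qed.

Local Notation Q := (iF (cF q)).
Local Notation t := (iF (tF C)).

Lemma iF_qB1 : iF (cF (q - 1)) = Q - 1.
Proof. by rewrite cF_morphE rmorphB rmorph1 -cF_morphE rmorphB rmorph1. Qed.

Lemma IDq_shiftE a : s a = a + (Q - 1) * (t * d 1 a).
Proof.
have c0 := cFtF_neq0.
rewrite d1 mulrA -iF_qB1 -rmorphM.
by rewrite mulrCA -rmorphM mulfV // rmorph1 mulr1 addrC subrK.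
Qed.

Lemma IDq_d_0 k : d k 0 = 0.
Proof. by apply: (addrI (d k 0)); rewrite -dD !addr0. Qed.

Lemma IDq_s_0 : s 0 = 0.
Proof. by apply: (addrI (s 0)); rewrite -sD !addr0. Qed.

Lemma IDq_dN k a : d k (- a) = - d k a.
Proof. by apply: (addrI (d k a)); rewrite -dD !subrr IDq_d_0. Qed.

Lemma IDq_iter1 i : iter i s 1 = 1.
Proof. by elim: i => //= i ->. Qed.

Lemma IDq_iter0 i : iter i s 0 = 0.
Proof. by elim: i => //= i ->; apply: IDq_s_0. Qed.

Lemma IDq_d_1 k : (0 < k)%N -> d k 1 = 0.
Proof.
elim/ltn_ind: k => k IH k0.
have := dM k 1 1; rewrite mul1r big_ord_recr /= subnn d0 IDq_iter1 mul1r.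
case: k k0 IH => // k _ IH.
rewrite big_ord_recl /= d0 subn0 mulr1 big1 ?addr0 => [|i _]; last first.
  by rewrite [d _.+1 1]IH ?mulr0 //= /bump ltnS.
by move=> /eqP; rewrite -subr_eq0 opprD addrA subrr sub0r oppr_eq0 => /eqP.
Qed.

Lemma IDq_dV i j a : d i (d j a) = d j (d i a).
Proof. by rewrite !dd qbin_sym [(i + j)%N]addnC. Qed.

Lemma IDq_d1_shift a : d 1 a = 0 -> s a = a.
Proof. by move=> da; rewrite IDq_shiftE da !mulr0 addr0. Qed.

Lemma IDq_shift_d1 a : s a = a -> d 1 a = 0.
Proof. by move=> sa; rewrite d1 sa subrr mul0r. Qed.

Lemma IDq_iter_const i a : s a = a -> iter i s a = a.
Proof. by move=> sa; elim: i => //= i ->. Qed.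

Lemma IDq_d_constM k a b : is_const d 0 a -> d k (a * b) = a * d k b.
Proof.
move=> ca; have sa : s a = a by apply: IDq_d1_shift; apply: ca.
rewrite dM big_ord_recr /= subnn d0 IDq_iter_const // big1 ?add0r // => i _.
by rewrite ca ?subn_gt0 // IDq_iter0 mul0r.
Qed.

Lemma IDq_sQ : s Q = Q.
Proof. by rewrite siF sigmaF_cF // IDq_q_neq0. Qed.

Lemma IDq_st : s t = Q * t.
Proof. by rewrite siF sigmaF_tF ?IDq_q_neq0 // rmorphM. Qed.

Lemma IDq_n_cancel (x : R) : n%:R * x = 0 -> x = 0.
Proof.
move=> nx; apply: (@iF_cancel (cF n%:R)); first by rewrite cF_eq0 IDq_n_neq0.
by rewrite cF_morphE !rmorph_nat.
Qed.

Lemma IDq_Qn : Q ^+ n = 1.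
Proof. by rewrite cF_morphE -!rmorphXn (prim_expr_order q_prim) !rmorph1. Qed.

(** The operators are only assumed additive, so constancy needs proof. Once the lower operators kill
    the shift-invariant q, delta^(k) obeys the ordinary product rule at powers of q; then q^n = 1
    gives n q^(n-1) delta^(k)(q) = 0, and n is invertible. *)
Lemma IDq_Q_const : is_const d 0 Q.
Proof.
elim/ltn_ind => k IH k0.
have QM f : d k (Q * f) = Q * d k f + d k Q * f.
  case: k k0 IH => // k _ IH.
  rewrite dM big_ord_recr big_ord_recl /= subnn subn0 !d0.
  rewrite big1 ?addr0 => [|i _]; last first.
    rewrite IH ?IDq_iter0 ?IDq_s_0 ?mul0r //= /bump /=; have := ltn_ord i; lia.
  by rewrite (IDq_iter_const _ IDq_sQ) IDq_sQ addrC.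
have dQ i : d k (Q ^+ i) = i%:R * Q ^+ i.-1 * d k Q.
  elim: i => [|i IHi]; first by rewrite expr0 IDq_d_1 // !mul0r.
  rewrite exprS QM IHi; case: i {IHi} => [|i]; first by rewrite expr0; ring.
  by rewrite /= -[i.+2%:R]natr1 exprS; ring.
have Q0 : Q ^+ n.-1 * (Q * d k Q) = d k Q.
  by rewrite mulrA -exprSr prednK ?IDq_Qn ?mul1r // ltnW.
apply: IDq_n_cancel; rewrite -Q0.
have := dQ n; rewrite IDq_Qn IDq_d_1 // => E.
by rewrite mulrCA mulrA [_ * n%:R]mulrC [_ * (Q * _)]mulrCA -E mulr0.
Qed.

Lemma IDq_d1_t : d 1 t = 1.
Proof.
have c0 := cFtF_neq0.
rewrite d1.
have -> : s t - t = iF (cF (q - 1) * tF C).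
  by rewrite rmorphM iF_qB1 IDq_st mulrBl mul1r.
by rewrite -rmorphM mulfV // rmorph1.
Qed.

Lemma IDq_iter_t i : iter i s t = Q ^+ i * t.
Proof.
elim: i => [|i IH] /=; first by rewrite mul1r.
rewrite IH sM IDq_st exprS mulrCA mulrA; congr (_ * _ * _).
by elim: i {IH} => //= i IH; rewrite exprS sM IH IDq_sQ.
Qed.

(** The last term vanishes by [IDq_d_t], but the induction there uses this formula while its top
    coefficient [d k.+2 t] is still unknown. *)
Let d_tM k f : (forall j, (1 < j < k.+2)%N -> d j t = 0) ->
  d k.+2 (t * f) = Q ^+ k.+2 * t * d k.+2 f + d k.+1 f + d k.+2 t * f.
Proof.
move=> IH; rewrite dM 2!big_ord_recr big_ord_recl /= !subnn subn0 !d0 subSnn.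
rewrite IDq_d1_t big1 => [|i _].
  rewrite -!/(iter _.+1 s _) -!iterS IDq_iter_t IDq_iter1 mul1r addr0.
  ring.
rewrite IH ?IDq_iter0 ?IDq_s_0 ?mul0r //= /bump /=.
by have := ltn_ord i; lia.
Qed.

(* The axioms only prescribe [d 1 t]. When n does not divide k, d^(1) d^(k-1) is a
   nonzero multiple of d^(k). When n | k, comparing d^(k) (t^n) = n (d^(k) t) t^(n-1) + const
   with the fact that t^n, hence d^(k) (t^n), is shift-invariant gives d^(k) t = 0. *)
Lemma IDq_d_t k : (1 < k)%N -> d k t = 0.
Proof.
elim/ltn_ind: k => k IH k1.
have IH' j : (1 < j < k)%N -> d j t = 0 by case/andP => ? ?; apply: IH.
have dtM j f : (j < k)%N ->
    d j (t * f) = Q ^+ j * t * d j f + (if j is j'.+1 then d j' f else 0).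
  case: j => [|[|j]] jk.
  - by rewrite !d0 expr0 mul1r addr0.
  - rewrite dM big_ord_recl big_ord1 /= subn0 subnn !d0 IDq_d1_t IDq_st; ring.
  - rewrite d_tM => [|i /andP[i1 ij]]; last by rewrite IH' // i1 (ltn_trans ij).
    by rewrite (IH' j.+2) // mul0r addr0.
have [/dvdnP[m km]|nk] := boolP (n %| k)%N; last first.
  have : d 1 (d k.-1 t) = 0.
    have [k2|k2] := eqVneq k 2; first by rewrite k2 /= IDq_d1_t IDq_d_1.
    by rewrite IH' ?IDq_d_0 //; move: k1 k2; clear; lia.
  rewrite dd add1n prednK; last by apply: ltnW.
  apply: iF_cancel; rewrite cF_eq0; apply/eqP => q0.
  have := qbin1 q k; rewrite q0 mulr0 => /esym/eqP; rewrite subr_eq0 => /eqP qk.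
  by move: nk; rewrite (prim_order_dvd q_prim) qk eqxx.
set T := d k t.
have Qk : Q ^+ k = 1 by rewrite km mulnC exprM IDq_Qn expr1n.
have nk : (n <= k)%N by rewrite km; move: k1; rewrite km; case: (m) => // m' _; rewrite mulSn leq_addr.
have dtX i j : (j < k)%N -> (i <= j)%N -> d j (t ^+ i) = (i == j)%:R.
  elim: i j => [|i IHi] j jk ij.
    by case: j jk ij => [|j] _ _; rewrite ?d0 ?IDq_d_1.
  case: j jk ij => // j jk ij; rewrite exprS dtM // !IHi ?(ltnW jk) ?(ltnW ij) //.
  by rewrite ltn_eqF // mulr0 add0r eqSS.
have dkX i : (i <= n)%N -> d k (t ^+ i) = i%:R * T * t ^+ i.-1 + (i == k)%:R.
  elim: i => [|i IHi] i_n; first by rewrite IDq_d_1 ?(ltnW k1) // !mul0r add0r ltn_eqF // ltnW.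
  have E := d_tM (k := k.-2) (t ^+ i); rewrite exprS.
  have k2 : k = k.-2.+2 by lia.
  rewrite -k2 in E; rewrite E // Qk mul1r IHi ?(ltnW i_n) // -/T.
  have -> : k.-2.+1 = k.-1 by lia.
  rewrite dtX; [|by lia|by lia].
  have -> : (i == k) = false by lia.
  have -> : (i == k.-1) = (i.+1 == k) by lia.
  by case: (i) => [|i']; rewrite ?expr0 -[_.+1%:R]natr1 ?exprS /=; ring.
have sT : s T = T.
  by apply: IDq_d1_shift; rewrite /T IDq_dV IDq_d1_t IDq_d_1 // ltnW.
have sX i : s (t ^+ i) = Q ^+ i * t ^+ i.
  by elim: i => [|i IHi]; rewrite ?mul1r // exprS sM IHi IDq_st exprS; ring.
have stn : d 1 (t ^+ n) = 0 by apply: IDq_shift_d1; rewrite sX IDq_Qn mul1r.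
have : d 1 (d k (t ^+ n)) = 0 by rewrite IDq_dV stn IDq_d_0.
rewrite dkX // dD => E.
have {}E : d 1 (n%:R * T * t ^+ n.-1) = 0.
  by move: E; case: (n == k); rewrite ?IDq_d_1 ?IDq_d_0 ?addr0.
have sN i : s i%:R = i%:R by elim: i => [|i IHi]; rewrite ?IDq_s_0 // -natr1 sD IHi s1.
(* n T t^(n-1) is shift-invariant, yet the shift multiplies it by q^(n-1). Multiplying by q gives (q
   - 1) n T t^(n-1) = 0, where all factors but T are invertible. *)
have {E} := IDq_d1_shift E; rewrite !sM sN sT sX => E.
apply: IDq_n_cancel; apply: (@iF_cancel (tF C ^+ n.-1)); first by rewrite expf_neq0 ?tF_neq0.
apply: (@iF_cancel (cF (q - 1))); first by rewrite cF_eq0 IDq_q_neq1.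
rewrite iF_qB1.
have QQ : Q * Q ^+ n.-1 = 1 by rewrite -exprS prednK ?IDq_Qn // ltnW.
rewrite rmorphXn mulrBl mul1r; apply/eqP; rewrite subr_eq0; apply/eqP.
transitivity (Q * (n%:R * T * t ^+ n.-1)); first by ring.
rewrite -{1}E; transitivity (Q * Q ^+ n.-1 * (n%:R * T * t ^+ n.-1)); first by ring.
by rewrite QQ; ring.
Qed.

Lemma IDq_d_tM k f :
  d k (t * f) = Q ^+ k * t * d k f + (if k is k'.+1 then d k' f else 0).
Proof.
case: k => [|[|k]].
- by rewrite !d0 expr0 mul1r addr0.
- rewrite dM big_ord_recl big_ord1 /= subn0 subnn !d0 IDq_d1_t IDq_st; ring.
- rewrite d_tM => [|i /andP[i1 _]]; last exact: IDq_d_t.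
  by rewrite (@IDq_d_t k.+2) // mul0r addr0.
Qed.

End IDqRingTheory.

Section LiftMorphism.
Variables (A T W : pzRingType) (i : {rmorphism T -> W}) (h : {rmorphism A -> W}).
Hypotheses (i_inj : injective i) (hi : forall a, exists y, i y = h a).

Definition lift_fun (a : A) : T := projT1 (cid (hi a)).

Lemma lift_funE a : i (lift_fun a) = h a.
Proof. exact: projT2 (cid (hi a)). Qed.

Lemma lift_fun_zmod : zmod_morphism lift_fun.
Proof. by move=> a b; apply: i_inj; rewrite rmorphB !lift_funE rmorphB. Qed.

Lemma lift_fun_monoid : monoid_morphism lift_fun.
Proof.
split=> [|a b]; apply: i_inj; first by rewrite lift_funE !rmorph1.
by rewrite rmorphM !lift_funE rmorphM.
Qed.

HB.instance Definition _ := GRing.isZmodMorphism.Build A T lift_fun lift_fun_zmod.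
HB.instance Definition _ := GRing.isMonoidMorphism.Build A T lift_fun lift_fun_monoid.

Lemma lift_rmorphism : exists h' : {rmorphism A -> T}, forall a, i (h' a) = h a.
Proof. by exists lift_fun; exact: lift_funE. Qed.

End LiftMorphism.

Lemma descend_fun (A T : Type) (p : A -> T) (o : A -> A) :
    (forall y, exists x, p x = y) -> (forall x y, p x = p y -> p (o x) = p (o y)) ->
  exists o' : T -> T, forall x, o' (p x) = p (o x).
Proof.
move=> /choice[g pg] po; exists (fun y => p (o (g y))) => x.
by apply: po; rewrite pg.
Qed.

Lemma iter_morph (A B : Type) (f : A -> B) (a : A -> A) (b : B -> B) i x :
  (forall x, f (a x) = b (f x)) -> f (iter i a x) = iter i b (f x).
Proof. by move=> fab; elim: i => //= i IH; rewrite fab IH. Qed.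

(** Bijectivity does not pass to stable subrings or quotients; finite order does, and q^n = 1 gives
    the shift order dividing n. *)
Lemma bijective_iter (A : Type) (n : nat) (s : A -> A) :
  (0 < n)%N -> (forall x, iter n s x = x) -> bijective s.
Proof.
move=> n0 sn; exists (iter n.-1 s) => x; first by rewrite -iterSr prednK.
by rewrite -iterS prednK.
Qed.

(** * Transfer of the axioms to subrings and quotients *)

Section Transfer.
Variables (C : closedFieldType) (q : C) (R T : comNzRingType).
Variables (iR : {rmorphism Ct C -> R}) (iT : {rmorphism Ct C -> T}).
Variables (s : R -> R) (d : nat -> R -> R) (s' : T -> T) (d' : nat -> T -> T).
Hypothesis s'_bij : bijective s'.

Lemma IDq_ring_injective (f : {rmorphism T -> R}) :
    injective f -> (forall x, f (iT x) = iR x) -> (forall x, f (s' x) = s (f x)) ->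
    (forall k x, f (d' k x) = d k (f x)) ->
  IDq_ring q iR s d -> IDq_ring q iT s' d'.
Proof.
move=> fi fT fs fd [sD [sM [s1 [_ [sF [d0 [d1 [dD [dM dd]]]]]]]]].
split; first by move=> a b; apply: fi; rewrite rmorphD !fs rmorphD sD.
split; first by move=> a b; apply: fi; rewrite rmorphM !fs rmorphM sM.
split; first by apply: fi; rewrite fs rmorph1 s1.
split; first by [].
split; first by move=> a; apply: fi; rewrite fs !fT sF.
split; first by move=> a; apply: fi; rewrite fd d0.
split; first by move=> a; apply: fi; rewrite fd d1 rmorphM rmorphB fs fT.
split; first by move=> k a b; apply: fi; rewrite rmorphD !fd rmorphD dD.
split.
  move=> k a b; apply: fi; rewrite fd rmorphM dM rmorph_sum; apply: eq_bigr => i _.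
  by rewrite rmorphM fd (iter_morph _ _ fs) fd.
by move=> i j a; apply: fi; rewrite rmorphM !fd fT dd.
Qed.

Lemma IDq_ring_surjective (f : {rmorphism R -> T}) :
    (forall y, exists x, f x = y) -> (forall x, f (iR x) = iT x) ->
    (forall x, f (s x) = s' (f x)) -> (forall k x, f (d k x) = d' k (f x)) ->
  IDq_ring q iR s d -> IDq_ring q iT s' d'.
Proof.
move=> fi fT fs fd [sD [sM [s1 [_ [sF [d0 [d1 [dD [dM dd]]]]]]]]].
split.
  by move=> a b; case: (fi a) (fi b) => x <- [y <-]; rewrite -rmorphD -!fs sD rmorphD.
split.
  by move=> a b; case: (fi a) (fi b) => x <- [y <-]; rewrite -rmorphM -!fs sM rmorphM.
split; first by rewrite -(rmorph1 f) -fs s1.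
split; first by [].
split; first by move=> a; rewrite -!fT -fs sF.
split; first by move=> a; case: (fi a) => x <-; rewrite -fd d0.
split.
  by move=> a; case: (fi a) => x <-; rewrite -fd d1 -fs -fT rmorphM rmorphB.
split.
  by move=> k a b; case: (fi a) (fi b) => x <- [y <-]; rewrite -rmorphD -!fd dD rmorphD.
split.
  move=> k a b; case: (fi a) (fi b) => x <- [y <-].
  rewrite -rmorphM -fd dM rmorph_sum; apply: eq_bigr => i _.
  by rewrite rmorphM fd (iter_morph _ _ fs) fd.
by move=> i j a; case: (fi a) => x <-; rewrite -!fd -fT -rmorphM dd.
Qed.

End Transfer.

Lemma ideal_shift_stable (C : closedFieldType) (n : nat) (q : C) (R : comNzRingType)
    (iF : {rmorphism Ct C -> R}) (s : R -> R) (d : nat -> R -> R) (I : R -> Prop) :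
    (2 <= n)%N -> n.-primitive_root q -> IDq_ring q iF s d ->
    is_ideal I -> (forall k x, I x -> I (d k x)) ->
  forall x, I x -> I (s x).
Proof.
move=> n2 qn H [I0 [ID IM]] Id x Ix; rewrite (IDq_shiftE n2 qn H).
by apply: ID => //; do 2!apply: (IM); apply: Id.
Qed.

(* A maximal proper [IDq]-ideal of a sub-[IDq]-ring [S] of [W] is quotiented out;
   [T0] is [S] as a type. *)
Lemma exists_simple_subquotient (C : closedFieldType) (n : nat) (q : C)
    (W : comNzRingType) (iW : {rmorphism Ct C -> W}) (s : W -> W) (d : nat -> W -> W)
    (S : W -> Prop) :
    (2 <= n)%N -> n.-primitive_root q -> IDq_ring q iW s d ->
    (forall x, iter n s x = x) ->
    is_subring S -> (forall x, S (iW x)) -> (forall x, S x -> S (s x)) ->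
    (forall k x, S x -> S (d k x)) ->
  exists (T0 T : comNzRingType) (i : {rmorphism T0 -> W}) (p : {rmorphism T0 -> T})
      (s0 : T0 -> T0) (d0 : nat -> T0 -> T0) (s' : T -> T) (d' : nat -> T -> T),
    [/\ injective i, forall x, S x <-> exists y, i y = x, forall y, exists x, p x = y
      & IDq_simple d'] /\
    [/\ forall x, i (s0 x) = s (i x), forall k x, i (d0 k x) = d k (i x),
        forall x, p (s0 x) = s' (p x), forall k x, p (d0 k x) = d' k (p x)
      & forall iT : {rmorphism Ct C -> T0}, (forall x, i (iT x) = iW x) ->
          IDq_ring q (p \o iT) s' d'].
Proof.
move=> n2 qn HW sn Sring SF Ss Sd.
have [T0 [i [i_inj iS]]] := exists_subring_type Sring.
have lift (o : W -> W) : (forall x, S x -> S (o x)) ->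
    exists o0 : T0 -> T0, forall x, i (o0 x) = o (i x).
  move=> So; suff /choice[o0 Ho] : forall x, exists y, i y = o (i x) by exists o0.
  by move=> x; apply/iS/So/iS; exists x.
have [s0 is0] := lift s Ss.
have /choice[d0 id0] : forall k, exists o : T0 -> T0, forall x, i (o x) = d k (i x).
  by move=> k; apply: lift; apply: Sd.
have s0n x : iter n s0 x = x by apply: i_inj; rewrite (iter_morph _ _ is0) sn.
have n0 : (0 < n)%N by apply: ltnW.
have s0_bij := bijective_iter n0 s0n.
have [iT iTE] : exists iT : {rmorphism Ct C -> T0}, forall x, i (iT x) = iW x.
  by apply: lift_rmorphism => // a; apply/iS.
have H0 := IDq_ring_injective s0_bij i_inj iTE is0 id0 HW.
(* Multiplications and the delta^(k) form one family of operators, so that a stable subgroup is an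
   ID_q-ideal; avoiding 1 makes it proper. *)
pose op (k : T0 + nat) (x : T0) := match k with inl r => r * x | inr k => d0 k x end.
have [||I [[I0 ID Iop] I1 Imax]] := @exists_maximal_stable T0 _ op (fun x => x = 1).
- by case=> [r|k] /=; rewrite ?mulr0 // (IDq_d_0 H0).
- by move=> /eqP; rewrite eq_sym oner_eq0.
have idI : is_ideal I by split=> //; split=> // r x; apply: (Iop (inl r)).
have Id k x : I x -> I (d0 k x) by apply: (Iop (inr k)).
have Is := ideal_shift_stable n2 qn H0 idI Id.
have nI1 : ~ I 1 by move/I1; apply.
have [T [p [p_surj p0]]] := exists_quotient idI nI1.
have pE x y : p x = p y <-> I (x - y).
  rewrite -p0 rmorphB; split=> [->|/eqP]; first by rewrite subrr.
  by rewrite subr_eq0 => /eqP.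
have desc (o : T0 -> T0) : (forall x y, o (x - y) = o x - o y) ->
    (forall x, I x -> I (o x)) -> exists o' : T -> T, forall x, p (o x) = o' (p x).
  move=> oB Io; have [|o' Ho] := descend_fun (o := o) p_surj; last by exists o'.
  by move=> x y /pE xy; apply/pE; rewrite -oB; apply: Io.
have s0B x y : s0 (x - y) = s0 x - s0 y.
  have [sD _] := H0; apply: (addIr (s0 y)); rewrite -sD !subrK //.
have [s' Hs'] := desc s0 s0B Is.
have /choice[d' Hd'] : forall k, exists o : T -> T, forall x, p (d0 k x) = o (p x).
  move=> k; apply: desc; last exact: Id.
  move=> x y; case: H0 => _ [_ [_ [_ [_ [_ [_ [dD _]]]]]]].
  by apply: (addIr (d0 k y)); rewrite -dD !subrK.
exists T0, T, i, p, s0, d0, s', d'; split; split=> //.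
- move=> J [J0 [JD JM]] Jd.
  (* A proper ID_q-ideal of the quotient pulls back to one that contains I and misses 1, hence to I
     by maximality. *)
  have stJ : stable_subgroup op (fun x => J (p x)).
    split; first by rewrite rmorph0.
      by move=> x y Jx Jy; rewrite rmorphD; apply: JD.
    move=> [r|k] x Jx /=; first by rewrite rmorphM; apply: JM.
    by rewrite Hd'; apply: Jd.
  have [J1|J1] := pselect (J 1).
    by right=> x; rewrite -[x]mulr1; apply: JM.
  left=> y Jy; have [x xy] := p_surj y; rewrite -xy in Jy *; apply/p0.
  apply: (Imax _ stJ _ _ x Jy) => z.
    by move=> /p0 ->.
  by move=> Jz z1; apply: J1; rewrite -(rmorph1 p) -z1.
- move=> iT' iT'E.
  have s'_bij : bijective s'.
    apply: (bijective_iter n0) => y; have [x <-] := p_surj y.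
    by rewrite -(iter_morph _ _ Hs') s0n.
  have H0' := IDq_ring_injective s0_bij i_inj iT'E is0 id0 HW.
  exact: (@IDq_ring_surjective _ _ _ _ iT' (p \o iT') _ _ _ _ s'_bij p p_surj
            (fun x => erefl) Hs' Hd' H0').
Qed.

(** * The q-Taylor expansion as a morphism *)

Section TaylorMap.
Variables (C : closedFieldType) (n : nat) (q : C).
Hypotheses (n_gt1 : (2 <= n)%N) (q_prim : n.-primitive_root q).
Variables (R : comNzRingType) (iF : {rmorphism Ct C -> R}) (s : R -> R) (d : nat -> R -> R).
Hypothesis HR : IDq_ring q iF s d.

Lemma IDq_constD a b : is_const d 0 a -> is_const d 0 b -> is_const d 0 (a + b).
Proof.
move=> ca cb k k0; case: HR => _ [_ [_ [_ [_ [_ [_ [dD _]]]]]]].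
by rewrite dD ca // cb // addr0.
Qed.

Lemma IDq_constN a : is_const d 0 a -> is_const d 0 (- a).
Proof. by move=> ca k k0; rewrite (IDq_dN HR) ca // oppr0. Qed.

Lemma IDq_constM a b : is_const d 0 a -> is_const d 0 b -> is_const d 0 (a * b).
Proof. by move=> ca cb k k0; rewrite (IDq_d_constM n_gt1 q_prim HR) // cb // mulr0. Qed.

Lemma IDq_const1 : is_const d 0 1.
Proof. by move=> k k0; apply: (IDq_d_1 HR). Qed.

Lemma IDq_const0 : is_const d 0 0.
Proof. by move=> k k0; apply: (IDq_d_0 HR). Qed.

Lemma IDq_const_qbin r k : is_const d 0 (iF (cF (qbin q r k))).
Proof.
rewrite cF_morphE !rmorph_qbin -cF_morphE.
have cQ := IDq_Q_const n_gt1 q_prim HR.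
have cX i : is_const d 0 (iF (cF q) ^+ i).
  by elim: i => [|i IH]; [exact: IDq_const1|rewrite exprS; apply: IDq_constM].
elim: r k => [|r IH] [|k] /=; try exact: IDq_const1; first exact: IDq_const0.
by apply: IDq_constD => //; apply: IDq_constM => //; apply: cX.
Qed.

Variables (Om : comNzRingType) (u : {rmorphism R -> Om}) (q' t' : Om).
Hypotheses (uq : u (iF (cF q)) = q') (ut : u (iF (tF C)) = t').

Local Notation W := (qtaylor q' t').

(** The point is a [t'] with an equation instead of the term [u (iF (tF C))], so that the expansions
    along two morphisms that agree on C(t) have values in the same type. *)
Definition taylor_map (a : R) : W := fun k => u (d k a).

Lemma u_qbin r k : u (iF (cF (qbin q r k))) = qbin q' r k.
Proof. by rewrite cF_morphE !rmorph_qbin -cF_morphE uq. Qed.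

Lemma taylor_mapD a b : taylor_map (a + b) = taylor_map a + taylor_map b.
Proof.
apply/funext => k; rewrite taddE /taylor_map.
by case: HR => _ [_ [_ [_ [_ [_ [_ [-> _]]]]]]]; rewrite rmorphD.
Qed.

Lemma taylor_map_d i a : taylor_map (d i a) = tdiff i (taylor_map a).
Proof.
apply/funext => k; rewrite /tdiff /taylor_map.
case: HR => _ [_ [_ [_ [_ [_ [_ [_ [_ ->]]]]]]]].
by rewrite rmorphM qbinomE u_qbin.
Qed.

Lemma taylor_map_const a : is_const d 0 a -> taylor_map a = tconst _ _ (u a).
Proof.
move=> ca; apply/funext => -[|k]; rewrite /taylor_map.
  by case: HR => _ [_ [_ [_ [_ [-> _]]]]].
by rewrite ca // rmorph0.
Qed.

Lemma taylor_map_constM a b : is_const d 0 a ->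
  taylor_map (a * b) = tconst _ _ (u a) * taylor_map b.
Proof.
move=> ca; apply/funext => k.
by rewrite tconstM /taylor_map (IDq_d_constM n_gt1 q_prim HR) // rmorphM.
Qed.

(** This is where delta^(k)(t) = 0 for k > 1 enters: only then does multiplication by t become
    multiplication by x. *)
Lemma taylor_map_tM b : taylor_map (iF (tF C) * b) = tpoly _ _ 'X * taylor_map b.
Proof.
rewrite -txmulE; apply/funext => k; rewrite /taylor_map /txmul.
rewrite (IDq_d_tM n_gt1 q_prim HR) rmorphD !rmorphM rmorphXn uq ut; congr (_ + _).
by case: k => //; rewrite rmorph0.
Qed.

Lemma taylor_map_s a : taylor_map (s a) = tshift (taylor_map a).
Proof.
have cQ1 : is_const d 0 (iF (cF q) - 1).
  apply: IDq_constD; first exact: (IDq_Q_const n_gt1 q_prim HR).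
  by apply: IDq_constN; apply: IDq_const1.
rewrite (IDq_shiftE n_gt1 q_prim HR) taylor_mapD taylor_map_constM // taylor_map_tM.
by rewrite taylor_map_d tshiftE rmorphB uq rmorph1.
Qed.

Lemma taylor_map_zmod : zmod_morphism taylor_map.
Proof. by move=> a b; apply: (addIr (taylor_map b)); rewrite -taylor_mapD !subrK. Qed.

(** Coefficient by coefficient this is the Leibniz rule of R, since the expansion commutes with the
    operators and the shift. *)
Lemma taylor_map_monoid : monoid_morphism taylor_map.
Proof.
split=> [|a b]; first by rewrite taylor_map_const ?rmorph1 //; apply: IDq_const1.
apply/funext => k; rewrite tmulE {1}/taylor_map.
have [_ [_ [_ [_ [_ [d0 [_ [_ [dM _]]]]]]]]] := HR.
rewrite dM rmorph_sum; apply: eq_bigr => i _.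
rewrite rmorphM -taylor_map_d -(iter_morph _ _ taylor_map_s); congr (_ * _).
by rewrite /taylor_map d0.
Qed.

HB.instance Definition _ := GRing.isZmodMorphism.Build R W taylor_map taylor_map_zmod.
HB.instance Definition _ := GRing.isMonoidMorphism.Build R W taylor_map taylor_map_monoid.

Lemma tpolyX_taylor_map : tpoly q' t' 'X = taylor_map (iF (tF C)).
Proof. by rewrite -[iF _]mulr1 taylor_map_tM (rmorph1 taylor_map) mulr1. Qed.

Lemma iter_tshift_q (f : W) : iter n (@tshift _ q' t') f = f.
Proof.
apply: iter_tshift_id.
by rewrite -uq -rmorphXn (IDq_Qn q_prim) // rmorph1.
Qed.

Lemma exists_taylor : exists th : {rmorphism R -> W},
  [/\ forall a k, th a k = u (d k a), forall a, th (s a) = tshift (th a),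
      forall k a, th (d k a) = tdiff k (th a) &
      IDq_ring q (th \o iF) (@tshift _ q' t') (@tdiff _ q' t')].
Proof.
exists taylor_map; split=> //; [exact: taylor_map_s|exact: taylor_map_d|].
split; first exact: tshiftD.
split; first exact: tshiftM.
split; first exact: tshift_const.
split; first exact: (bijective_iter (ltnW n_gt1) iter_tshift_q).
split.
  move=> f /=; rewrite -taylor_map_s.
  by have [_ [_ [_ [_ [-> _]]]]] := HR.
split; first exact: tdiff0.
split.
  (* The image of (q - 1) t in W is invertible, so [tshiftE] can be solved for the first divided
     difference. *)
  have c0 := cFtF_neq0 n_gt1 q_prim.
  move=> f /=; have := tshiftE f; rewrite tpolyX_taylor_map.
  have -> : tconst q' t' (q' - 1) = taylor_map (iF (cF (q - 1))).
    rewrite taylor_map_const; last first.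
      rewrite iF_qB1; apply: IDq_constD; first exact: (IDq_Q_const n_gt1 q_prim HR).
      by apply: IDq_constN; apply: IDq_const1.
    by rewrite iF_qB1 rmorphB uq rmorph1.
  rewrite mulrA -(rmorphM taylor_map) -(rmorphM iF) => ->.
  move: (cF (q - 1) * tF C) c0 => x c0.
  rewrite addrAC subrr add0r mulrAC -(rmorphM taylor_map) -(rmorphM iF) mulfV //.
  by rewrite !rmorph1 mul1r.
split; first exact: tdiffD.
split; first exact: tdiffM.
move=> i j f /=; rewrite tdiff_comp qbinomE taylor_map_const ?u_qbin //.
exact: IDq_const_qbin.
Qed.

End TaylorMap.

(** * Constants of simple extensions *)

Section Constants.
Variables (C : closedFieldType) (n : nat) (q : C).
Hypotheses (n_gt1 : (2 <= n)%N) (q_prim : n.-primitive_root q).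
Variables (L : fieldType) (iL : {rmorphism Ct C -> L}) (sL : L -> L) (dL : nat -> L -> L).
Hypothesis HL : IDq_field_algclosed_consts q iL sL dL.

(** The algebraically closed field of constants is infinite, by Euclid's argument. *)
Lemma exists_constant_nonroot (f : {poly L}) : f != 0 ->
  exists2 a, is_const dL 0 a & f.[a] != 0.
Proof.
have [HLr HLc] := HL.
move=> f0; apply: contrapT => allroot.
have rootf a : is_const dL 0 a -> root f a.
  by move=> ca; apply/negPn/negP => ra; apply: allroot; exists a.
have many m : exists rs : seq L, [/\ uniq rs, size rs = m &
    forall a, a \in rs -> is_const dL 0 a].
  elim: m => [|m [rs [urs srs crs]]]; first by exists [::].
  pose p : {poly L} := \prod_(a <- rs) ('X - a%:P).
  have cp : forall i, is_const dL 0 p`_i.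
    rewrite /p; elim: (rs) crs => [|a s IH] crs i.
      rewrite big_nil coef1; case: (i == 0%N); first exact: (IDq_const1 HLr).
      exact: (IDq_const0 HLr).
    have {}IH := IH (fun b bs => crs b (mem_behead (s := a :: s) bs)).
    rewrite big_cons mulrBl coefB coefXM coefCM; apply: (IDq_constD HLr).
      by case: (i == 0%N); [exact: (IDq_const0 HLr)|exact: IH].
    apply: (IDq_constN HLr); apply: (IDq_constM n_gt1 q_prim HLr); last exact: IH.
    by apply: crs; rewrite mem_head.
  have p0 : p != 0 by apply: monic_neq0; apply: monic_prod_XsubC.
  (* X p + 1 takes the value 1 at every element of [rs], so its constant root is new; the factor X
     keeps it nonconstant when [rs] is empty. *)
  have spX : (1 < size (p * 'X + 1%:P)%R)%N.
    have E : size (p * 'X) = (size p).+1 by rewrite size_mulX.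
    by rewrite size_polyDl E ?size_polyC ?oner_neq0 ltnS size_poly_gt0.
  have [i|a ca /rootP] := HLc _ _ spX.
    rewrite coefD coefMX coefC; apply: (IDq_constD HLr); case: (i == 0%N) => //;
      by [exact: (IDq_const0 HLr)|exact: (IDq_const1 HLr)].
  rewrite hornerD hornerMX hornerC => pa.
  exists (a :: rs); rewrite /= srs; split=> //.
    rewrite urs andbT; apply/negP => ars; move/eqP: pa.
    have /rootP -> : root p a by rewrite root_prod_XsubC.
    by rewrite mul0r add0r oner_eq0.
  by move=> b; rewrite inE => /orP[/eqP ->|/crs].
have [rs [urs srs crs]] := many (size f).
have allr : all (root f) rs by apply/allP => a /crs /rootf.
by have := max_poly_roots f0 allr urs; rewrite srs ltnn.
Qed.

Variables (R : comNzRingType) (j : {rmorphism L -> R}) (s : R -> R) (d : nat -> R -> R).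
Hypotheses (HR : IDq_ext q iL sL dL j s d) (simpleR : IDq_simple d).

Let HRr : IDq_ring q (j \o iL) s d. Proof. by case: HR. Qed.
Let dj : forall k a, d k (j a) = j (dL k a). Proof. by case: HR => _ []. Qed.

(** Operators commute with multiplication by a constant, so c - a generates an ID_q-ideal, which is
    0 or the whole ring. *)
Lemma constant_eq_or_unit c a : is_const d 0 c -> is_const dL 0 a ->
  c = j a \/ exists u, u * (c - j a) = 1.
Proof.
move=> cc ca.
have cca : is_const d 0 (c - j a).
  apply: (IDq_constD HRr) => //; apply: (IDq_constN HRr) => k k0.
  by rewrite dj ca // rmorph0.
have [||I0|I1] := simpleR (I := fun x => exists r, x = r * (c - j a)).
- split; first by exists 0; rewrite mul0r.
  split; first by move=> _ _ [r ->] [r' ->]; exists (r + r'); rewrite mulrDl.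
  by move=> r _ [r' ->]; exists (r * r'); rewrite mulrA.
- move=> k _ [r ->]; exists (d k r).
  by rewrite mulrC (IDq_d_constM n_gt1 q_prim HRr) // mulrC.
- left; apply/eqP; rewrite -subr_eq0; apply/eqP/I0.
  by exists 1; rewrite mul1r.
- by have [u u1] := I1 1; right; exists u.
Qed.

Lemma algebraic_constant (p : {poly L}) c : is_const d 0 c -> p != 0 ->
  (map_poly j p).[c] = 0 -> exists2 l, is_const dL 0 l & j l = c.
Proof.
move=> cc; have [HLr HLc] := HL.
have cX i : is_const d 0 (c ^+ i).
  elim: i => [|i IH]; first exact: (IDq_const1 HRr).
  by rewrite exprS; apply: (IDq_constM n_gt1 q_prim HRr).
move: {2}(size p) (leqnn (size p)) => m.
elim: m p => [|m IH] p; first by rewrite leqn0 size_poly_eq0 => ->.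
move=> spm p0 pc.
pose p1 := (lead_coef p)^-1 *: p.
have lp0 : lead_coef p != 0 by rewrite lead_coef_eq0.
have sp1 : size p1 = size p by rewrite size_scale // invr_neq0.
have p1c : (map_poly j p1).[c] = 0.
  by rewrite /p1 linearZ /= hornerZ pc mulr0.
have lp1 : lead_coef p1 = 1 by rewrite lead_coefZ mulVf.
have p10 : p1 != 0 by rewrite -lead_coef_eq0 lp1 oner_neq0.
have [constp|] := pselect (forall k, (0 < k)%N -> forall i, dL k p1`_i = 0); last first.
  move=> /existsNP[k] /not_implyP[k0] /existsNP[i dki].
  (* The leading coefficient 1 is killed, so the degree drops; c remains a root because its powers
     are constants. *)
  pose pk := \poly_(i < size p1) dL k p1`_i.
  apply: (IH pk).
  - rewrite -ltnS; apply: leq_trans spm; rewrite -sp1 -[size p1]prednK ?size_poly_gt0 //.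
    rewrite ltnS; apply/leq_sizeP => l; rewrite leq_eqVlt coef_poly => /orP[/eqP <-|ll].
      by rewrite -/(lead_coef p1) lp1 (IDq_d_1 HLr) // if_same.
    by rewrite ltnNge; move: ll; case: (size p1) => //= _ ->.
  - apply/eqP => pk0; apply: dki; move: (congr1 (fun r : {poly L} => r`_i) pk0).
    rewrite coef_poly coef0; case: ltnP => // sz _.
    by rewrite nth_default // (IDq_d_0 HLr).
  - have := congr1 (d k) p1c; rewrite (IDq_d_0 HRr) => <-.
    rewrite (horner_coef_wide c (n := size p1)); last first.
      by rewrite (leq_trans (size_poly _ _)) // size_poly.
    rewrite (horner_coef_wide c (n := size p1)); last by rewrite size_poly.
    rewrite (big_morph (d k) (id1 := 0) (op1 := +%R)); last exact: (IDq_d_0 HRr); last first.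
      by case: HRr => _ [_ [_ [_ [_ [_ [_ [dD _]]]]]]] x y; rewrite dD.
    apply: eq_bigr => i0 _; rewrite !coef_map coef_poly ltn_ord /=.
    by rewrite [in RHS]mulrC (IDq_d_constM n_gt1 q_prim HRr) // dj mulrC.
have sp1_gt1 : (1 < size p1)%N.
  rewrite ltnNge; apply/negP => /size1_polyC E; move: p1c lp1.
  rewrite E map_polyC hornerC lead_coefC /= => jp lc1; move/eqP: jp.
  by rewrite lc1 rmorph1 oner_eq0.
have [|a ca /factor_theorem[p' p'E]] := HLc p1 _ sp1_gt1.
  by move=> i k k0; apply: constp.
(* In a ring that may have zero divisors the factor X - a can still be removed, because c - a is a
   unit unless c = a. *)
have [->|[u uc]] := constant_eq_or_unit cc ca; first by exists a.
have p'0 : p' != 0 by apply: contra_neq p10 => p'0; rewrite p'E p'0 mul0r.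
apply: (IH p') => //.
  rewrite -ltnS; apply: leq_trans spm; rewrite -sp1 p'E size_Mmonic ?monicXsubC //.
  by rewrite size_XsubC addn2.
move: p1c; rewrite p'E rmorphM hornerM /= rmorphB /= map_polyX map_polyC.
rewrite hornerXsubC /= => E.
by rewrite -[LHS]mulr1 -uc mulrCA E mulr0.
Qed.

Lemma constants_finitely_generated (ys : seq R) (c : R) :
  generated j ys -> is_const d 0 c -> exists2 l, is_const dL 0 l & j l = c.
Proof.
move=> gen cc.
have [[p [p0 pc]]|trans] :=
    pselect (exists p : {poly L}, p != 0 /\ (map_poly j p).[c] = 0).
  exact: algebraic_constant pc.
have [|f f0 fa] := generic_nonunit (c := c) gen.
  by move=> p p0 pc; apply: trans; exists p.
have [a ca /eqP[]] := exists_constant_nonroot f0.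
have [ea|[u uc]] := constant_eq_or_unit cc ca; last exact: fa uc.
case: trans; exists ('X - a%:P); split; first by rewrite polyXsubC_eq0.
by rewrite rmorphB /= map_polyX map_polyC hornerXsubC ea subrr.
Qed.

End Constants.

Lemma exists_rmorphism (A B : pzRingType) (f : A -> B) :
    zmod_morphism f -> monoid_morphism f ->
  exists g : {rmorphism A -> B}, forall x, g x = f x.
Proof.
move=> f1 f2.
pose F1 := GRing.isZmodMorphism.Build A B f f1.
pose F2 := GRing.isMonoidMorphism.Build A B f f2.
pose g : {rmorphism A -> B} := HB.pack f F1 F2.
by exists g.
Qed.

Lemma IDq_ring_ext (C : closedFieldType) (q : C) (R : comNzRingType)
    (iF iF' : {rmorphism Ct C -> R}) s d :
  (forall x, iF x = iF' x) -> IDq_ring q iF s d -> IDq_ring q iF' s d.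
Proof.
move=> E [sD [sM [s1 [sb [sF [d0 [d1 [dD [dM dd]]]]]]]]].
do 4![split=> //]; split; first by move=> f; rewrite -!E.
split=> //; split; first by move=> a; rewrite -E.
by split=> //; split=> // i j a; rewrite -E.
Qed.

(** * Fundamental solution matrices *)

Section MatrixOperators.
Variables (C : closedFieldType) (n : nat) (q : C).
Hypotheses (n_gt1 : (2 <= n)%N) (q_prim : n.-primitive_root q).
Variables (R : comNzRingType) (iF : {rmorphism Ct C -> R}) (s : R -> R) (d : nat -> R -> R).
Hypothesis HR : IDq_ring q iF s d.
Variable r : nat.
Implicit Types A B : 'M[R]_r.

Let sD : forall a b, s (a + b) = s a + s b. Proof. by case: HR. Qed.
Let sM : forall a b, s (a * b) = s a * s b. Proof. by case: HR => _ []. Qed.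
Let d0 : forall a, d 0 a = a. Proof. by case: HR => _ [_ [_ [_ [_ []]]]]. Qed.
Let dD : forall k a b, d k (a + b) = d k a + d k b.
Proof. by case: HR => _ [_ [_ [_ [_ [_ [_ []]]]]]]. Qed.
Let dM : forall k a b, d k (a * b) = \sum_(i < k.+1) iter i s (d (k - i)%N a) * d i b.
Proof. by case: HR => _ [_ [_ [_ [_ [_ [_ [_ []]]]]]]]. Qed.

Lemma IDq_iter_rmorphism i : exists g : {rmorphism R -> R}, forall x, g x = iter i s x.
Proof.
apply: exists_rmorphism.
  have sB a b : s (a - b) = s a - s b by apply: (addIr (s b)); rewrite -sD !subrK.
  by elim: i => // i IH a b /=; rewrite IH sB.
split; first by apply: (IDq_iter1 HR).
by elim: i => // i IH a b /=; rewrite IH sM.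
Qed.

Lemma IDq_d_sum k (I : Type) (l : seq I) (P : pred I) (F : I -> R) :
  d k (\sum_(i <- l | P i) F i) = \sum_(i <- l | P i) d k (F i).
Proof. by apply: (big_morph (d k) (dD k)); exact: (IDq_d_0 HR). Qed.

Lemma map_iter_mul i A B :
  map_mx (iter i s) (A *m B) = map_mx (iter i s) A *m map_mx (iter i s) B.
Proof.
have [g gE] := IDq_iter_rmorphism i.
by rewrite -!(eq_map_mx _ gE) map_mxM.
Qed.

Lemma map_iter_1 i : map_mx (iter i s) (1%:M : 'M[R]_r) = 1%:M.
Proof. by have [g gE] := IDq_iter_rmorphism i; rewrite -!(eq_map_mx _ gE) map_mx1. Qed.

Lemma map_d_mul k A B : map_mx (d k) (A *m B) =
  \sum_(i < k.+1) map_mx (iter i s) (map_mx (d (k - i)) A) *m map_mx (d i) B.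
Proof.
apply/matrixP => a b; rewrite !mxE summxE IDq_d_sum.
under eq_bigr do rewrite dM.
rewrite exchange_big /=; apply: eq_bigr => i _; rewrite mxE.
by apply: eq_bigr => c _; rewrite !mxE.
Qed.

(** The skew Leibniz rule with the shift on the second factor. Entries commute but matrices do not,
    so both forms occur. *)
Lemma map_d_mulr k A B : map_mx (d k) (A *m B) =
  \sum_(i < k.+1) map_mx (d i) A *m map_mx (iter i s) (map_mx (d (k - i)) B).
Proof.
apply/matrixP => a b; rewrite !mxE summxE IDq_d_sum.
under eq_bigr do rewrite mulrC dM.
rewrite exchange_big /=; apply: eq_bigr => i _; rewrite mxE.
by apply: eq_bigr => c _; rewrite !mxE mulrC.
Qed.

Lemma map_d0 A : map_mx (d 0) A = A.
Proof. by apply/matrixP => a b; rewrite mxE d0. Qed.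

Lemma map_d_1 k : (0 < k)%N -> map_mx (d k) (1%:M : 'M[R]_r) = 0.
Proof.
move=> k0; apply/matrixP => a b; rewrite !mxE.
by case: (a == b); rewrite ?(IDq_d_1 HR) ?(IDq_d_0 HR).
Qed.

Lemma map_shiftE A : map_mx s A =
  A + ((iF (cF q) - 1) * iF (tF C)) *: map_mx (d 1) A.
Proof.
by apply/matrixP => a b; rewrite !mxE (IDq_shiftE n_gt1 q_prim HR) mulrA.
Qed.

Definition fundamental (G : nat -> 'M[R]_r) (Y : 'M[R]_r) : Prop :=
  forall k, (0 < k)%N ->
    \sum_(i < k.+1) G i *m map_mx (iter i s) (map_mx (d (k - i)%N) Y) = 0.

(** Multiplied by A on the left, the k-th equation becomes the Leibniz expansion of delta^(k)(A Y) =
    delta^(k)(1) = 0. *)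
Lemma fundamental_inverse (G : nat -> 'M[R]_r) A Y :
    (forall k, map_mx (d k) A = A *m G k) -> A *m Y = 1%:M -> Y *m A = 1%:M ->
  fundamental G Y.
Proof.
move=> dA AY YA k k0; set E := \sum_(i < _) _.
rewrite -[E]mul1mx -YA -mulmxA.
have -> : A *m E = map_mx (d k) (A *m Y).
  rewrite map_d_mulr mulmx_sumr; apply: eq_bigr => i _.
  by rewrite dA mulmxA.
by rewrite AY map_d_1 // mulmx0.
Qed.

Lemma fundamental_shift (G : nat -> 'M[R]_r) Y : G 0%N = 1%:M -> fundamental G Y ->
  Y = (1%:M + ((iF (cF q) - 1) * iF (tF C)) *: G 1%N) *m map_mx s Y.
Proof.
move=> G0 FY; have := FY 1%N isT.
rewrite big_ord_recl big_ord1 /= G0 mul1mx subn0 subnn map_d0 => /eqP.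
have -> : map_mx id (map_mx (d 1) Y) = map_mx (d 1) Y by apply/matrixP => a b; rewrite !mxE.
rewrite addr_eq0 => /eqP E.
rewrite mulmxDl mul1mx -scalemxAl -[_ *m _]opprK -E {1}map_shiftE.
by rewrite scalerN addrK.
Qed.

(** Write Y2 = Y1 g. By induction delta^(k)(Y1 g) = delta^(k)(Y1) g + sigma^k(Y1) delta^(k)(g);
    subtracting the equation of Y1 times g from that of Y2 leaves sigma^k(Y1) delta^(k)(g) = 0, with
    sigma^k(Y1) invertible. *)
Lemma fundamental_ratio (G : nat -> 'M[R]_r) Y1 Z1 Y2 : G 0%N = 1%:M ->
    fundamental G Y1 -> fundamental G Y2 -> Y1 *m Z1 = 1%:M -> Z1 *m Y1 = 1%:M ->
  forall a b, is_const d 0 ((Z1 *m Y2) a b).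
Proof.
move=> G0 F1 F2 YZ ZY.
set g := Z1 *m Y2.
have Y2E : Y2 = Y1 *m g by rewrite mulmxA YZ mul1mx.
have smul (A B : 'M[R]_r) : map_mx s (A *m B) = map_mx s A *m map_mx s B.
  exact: (map_iter_mul 1).
have sZ : map_mx s Y1 *m map_mx s Z1 = 1%:M by rewrite -smul YZ; exact: (map_iter_1 1).
(* Shift invariance comes first, since sigma^i(g) must reduce to g in the sums below. It holds
   because Y = Phi sigma(Y) with the same Phi for both solutions. *)
have sg : map_mx s g = g.
  have E1 := fundamental_shift G0 F1; have E2 := fundamental_shift G0 F2.
  pose Phi : 'M[R]_r := 1%:M + ((iF (cF q) - 1) * iF (tF C)) *: G 1%N.
  rewrite -/Phi in E1 E2.
  have PhiE : Phi = Y1 *m map_mx s Z1 by rewrite [in RHS]E1 -mulmxA sZ mulmx1.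
  by rewrite [in RHS]/g E2 PhiE !mulmxA ZY mul1mx -smul.
have sig i : map_mx (iter i s) g = g.
  apply/matrixP => a b; rewrite mxE; apply: IDq_iter_const.
  by move/matrixP: sg => /(_ a b); rewrite mxE.
suff dg k : (0 < k)%N -> map_mx (d k) g = 0.
  by move=> a b k k0; have /matrixP/(_ a b) := dg k k0; rewrite !mxE.
have mid (B : 'M[R]_r) : map_mx id B = B by apply/matrixP => a b; rewrite mxE.
elim/ltn_ind: k => k IH k0.
have dYg m : (m < k)%N -> map_mx (d m) (Y1 *m g) = map_mx (d m) Y1 *m g.
  move=> mk; rewrite map_d_mul big_ord_recl big1 ?addr0 => [|i _].
    rewrite subn0 map_d0; congr (_ *m _).
    by apply/matrixP => a b; rewrite !mxE.
  by rewrite IH ?mulmx0 //= /bump /=; apply: leq_ltn_trans mk.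
have dYgk : map_mx (d k) (Y1 *m g) =
    map_mx (d k) Y1 *m g + map_mx (iter k s) Y1 *m map_mx (d k) g.
  case: k k0 IH {dYg} => // k _ IH.
  rewrite map_d_mul big_ord_recl big_ord_recr /= big1 ?add0r => [|i _].
    by rewrite subn0 subnn !map_d0 mid.
  by rewrite IH ?mulmx0 //= /bump /=; have := ltn_ord i; lia.
have := F2 k k0; rewrite Y2E; case: k k0 IH dYg dYgk => // k k0 IH dYg dYgk.
rewrite big_ord_recl /= subn0 dYgk.
under eq_bigr => i _.
  rewrite dYg; last by rewrite /bump /=; have := ltn_ord i; lia.
  rewrite map_iter_mul sig mulmxA; over.
have := F1 k.+1 k0; rewrite big_ord_recl /= subn0.
rewrite !mid G0 !mul1mx -mulmx_suml => /eqP; rewrite addr_eq0 => /eqP E.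
rewrite addrAC E mulNmx addNr add0r => Yg.
have := congr1 (mulmx (map_mx (iter k.+1 s) Z1)) Yg.
by rewrite mulmxA -map_iter_mul ZY map_iter_1 mul1mx mulmx0.
Qed.

End MatrixOperators.

(** * Matrices of the operators of M *)

Section ModuleMatrices.
Variables (C : closedFieldType) (n : nat) (q : C).
Hypotheses (n_gt1 : (2 <= n)%N) (q_prim : n.-primitive_root q).
Variables (L : fieldType) (iL : {rmorphism Ct C -> L}) (sL : L -> L) (dL : nat -> L -> L).
Hypothesis HL : IDq_ring q iL sL dL.
Variables (M : vectType L) (dM : nat -> M -> M).
Hypothesis HM : IDq_module q iL sL dL dM.
Variable e : (\dim (fullv : {vspace M})).-tuple M.
Hypothesis He : basis_of fullv e.

Local Notation r := (\dim (fullv : {vspace M})).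
Local Notation G := (Defs.delta_mx dM e).

Let dM0 : forall m, dM 0 m = m. Proof. by case: HM. Qed.
Let dMD : forall k m m', dM k (m + m') = dM k m + dM k m'.
Proof. by case: HM => _ [_ []]. Qed.
Let dMZ : forall k (a : L) m, dM k (a *: m) =
  \sum_(i < k.+1) iter i sL (dL (k - i)%N a) *: dM i m.
Proof. by case: HM => _ [_ [_ []]]. Qed.

Lemma dM_0 k : dM k 0 = 0.
Proof. by apply: (addrI (dM k 0)); rewrite -dMD !addr0. Qed.

Lemma dM_sum k (I : Type) (l : seq I) (F : I -> M) :
  dM k (\sum_(i <- l) F i) = \sum_(i <- l) dM k (F i).
Proof. by apply: (big_morph (dM k) (dMD k)); exact: dM_0. Qed.

Let coord_e (a b : 'I_r) : coord e a e`_b = (a == b)%:R.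
Proof. by rewrite coord_free ?(basis_free He) // eq_sym. Qed.

Let expand (m : M) : m = \sum_(a < r) coord e a m *: e`_a.
Proof. exact: (coord_basis He (memvf m)). Qed.

Lemma delta_mx0 : G 0%N = 1%:M.
Proof. by apply/matrixP => a b; rewrite !mxE dM0 coord_e. Qed.

Lemma coord_dM k m (a : 'I_r) : coord e a (dM k m) =
  \sum_(i < k.+1) \sum_(b < r) G i a b * iter i sL (dL (k - i)%N (coord e b m)).
Proof.
rewrite {1}(expand m) dM_sum linear_sum /=.
under eq_bigr => b _.
  rewrite dMZ linear_sum /=.
  under eq_bigr do rewrite linearZ /= mulrC.
  over.
rewrite exchange_big; apply: eq_bigr => i _; apply: eq_bigr => b _.
by rewrite mxE.
Qed.

Lemma delta_mx_comp l i :
  \sum_(k < l.+1) G k *m map_mx (iter k sL) (map_mx (dL (l - k)%N) (G i)) =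
  iL (cF (qbin q (l + i) l)) *: G (l + i)%N.
Proof.
apply/matrixP => a b; rewrite !mxE summxE.
have dd : dM l (dM i e`_b) = iL (cF (qbin q (l + i) l)) *: dM (l + i)%N e`_b.
  by case: HM => _ [_ [_ [_ ->]]]; rewrite qbinomE.
have := congr1 (coord e a) dd; rewrite linearZ /= => <-.
rewrite coord_dM; apply: eq_bigr => k _; rewrite mxE.
by apply: eq_bigr => c _; rewrite !mxE.
Qed.

Local Notation c := (iL (cF (q - 1) * tF C)).
Definition frobenius_mx : 'M[L]_r := 1%:M + c *: G 1%N.

(** This is the matrix of phi_M, which is sigma-semilinear; the inverse therefore has as columns the
    shifted coordinates of the preimages of the basis vectors. *)
Lemma frobenius_mx_unit : exists X, frobenius_mx *m X = 1%:M /\ X *m frobenius_mx = 1%:M.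
Proof.
have [_ [[phi' _ phiK] _]] := HM.
pose X : 'M[L]_r := \matrix_(a, b) sL (coord e a (phi' e`_b)).
suff FX : frobenius_mx *m X = 1%:M by exists X; split=> //; apply: mulmx1C.
have sE x : sL x = x + c * dL 1 x.
  by rewrite (IDq_shiftE n_gt1 q_prim HL) mulrA -iF_qB1 -rmorphM.
apply/matrixP => a b; have := congr1 (coord e a) (phiK e`_b).
rewrite linearD linearZ /= coord_e coord_dM big_ord_recl big_ord1 /= subn0 subnn.
have [_ [_ [_ [_ [_ [dL0 _]]]]]] := HL.
move=> E; rewrite [RHS]mxE -E mulmxDl mul1mx -scalemxAl !mxE.
set m := phi' _.
rewrite sE [RHS]addrC -addrA; congr (_ + _); rewrite -mulrDr; congr (_ * _).
congr (_ + _).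
  rewrite (bigD1 a) //= big1 ?addr0 => [|b' ba]; first by rewrite delta_mx0 mxE eqxx mul1r.
  by rewrite delta_mx0 mxE eq_sym (negbTE ba) mul0r.
by apply: eq_bigr => b' _; rewrite !mxE dL0.
Qed.

End ModuleMatrices.

(** * The invertible matrix of q-Taylor coefficients over W *)

Section TaylorSolution.
Variables (C : closedFieldType) (n : nat) (q : C).
Hypotheses (n_gt1 : (2 <= n)%N) (q_prim : n.-primitive_root q).
Variables (L : fieldType) (iL : {rmorphism Ct C -> L}) (sL : L -> L) (dL : nat -> L -> L).
Hypothesis HL : IDq_ring q iL sL dL.
Variables (M : vectType L) (dM : nat -> M -> M).
Hypothesis HM : IDq_module q iL sL dL dM.
Variable e : (\dim (fullv : {vspace M})).-tuple M.
Hypothesis He : basis_of fullv e.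

Local Notation r := (\dim (fullv : {vspace M})).
Local Notation G := (Defs.delta_mx dM e).
Local Notation W := (qtaylor (iL (cF q)) (iL (tF C))).

Variable th : {rmorphism L -> W}.
Hypotheses (thE : forall a k, th a k = dL k a)
  (th_s : forall a, th (sL a) = tshift (th a))
  (th_d : forall k a, th (dL k a) = tdiff k (th a))
  (HW : IDq_ring q (th \o iL) (@tshift _ (iL (cF q)) (iL (tF C))) (@tdiff _ _ _)).

Definition taylor_mx : 'M[W]_r := \matrix_(a, b) (fun k => G k a b).

Local Notation A := taylor_mx.

(** Coefficient l of this equation is the iteration rule for the composite of delta_M^(l) and
    delta_M^(k), written in matrices as [delta_mx_comp]. *)
Lemma taylor_mx_d k : map_mx (@tdiff _ _ _ k) A = A *m map_mx th (G k).
Proof.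
apply/matrixP => a b; apply/funext => l; rewrite !mxE.
transitivity ((iL (cF (qbin q (l + k) l)) *: G (l + k)%N) a b).
  rewrite mxE /tdiff mxE; congr (_ * _).
  by rewrite [in RHS]cF_morphE !rmorph_qbin -cF_morphE.
rewrite -(delta_mx_comp HM He) summxE.
have -> : \sum_j A a j * (map_mx th (G k)) j b = \sum_j map_mx th (G k) j b * A a j.
  by apply: eq_bigr => j _; rewrite mulrC.
rewrite tsumE; under [RHS]eq_bigr do rewrite tmulE.
rewrite [RHS]exchange_big; apply: eq_bigr => i _; rewrite mxE; apply: eq_bigr => j _.
rewrite mulrC !mxE -th_d -(iter_morph _ _ th_s) thE; congr (_ * _).
by have [_ [_ [_ [_ [_ [-> _]]]]]] := HL.
Qed.

Lemma taylor_mx_shift : map_mx (@tshift _ _ _) A = A *m map_mx th (frobenius_mx q iL dM e).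
Proof.
rewrite (map_shiftE n_gt1 q_prim HW) taylor_mx_d /frobenius_mx map_mxD map_mx1.
rewrite mulmxDr mulmx1 map_mxZ -scalemxAr; congr (_ + _ *: _).
by rewrite [in RHS]rmorphM iF_qB1 [in RHS]rmorphM rmorphB rmorph1.
Qed.

(** det A has the value 1 at t because G_0 = 1, and each shift multiplies it by the expansion of the
    nonzero determinant of phi_M. All its values at the points q^i t are thus nonzero in L, as
    [tunit] requires. *)
Lemma taylor_mx_unit : exists Y : 'M[W]_r, A *m Y = 1%:M /\ Y *m A = 1%:M.
Proof.
have [X [PX XP]] := frobenius_mx_unit n_gt1 q_prim HL HM He.
set P := frobenius_mx _ _ _ _ in PX XP.
have dP0 : \det P != 0.
  apply/eqP => dP; have := congr1 determinant PX.
  by rewrite det_mulmx dP mul0r det1 => /esym/eqP; rewrite oner_eq0.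
have [sg sgE] := IDq_iter_rmorphism HW 1.
have [_ [_ [_ [HLb [_ [HL0 _]]]]]] := HL.
have detA0 : (\det A) 0%N = 1.
  have [ev evE] : exists ev : {rmorphism W -> L}, forall f, ev f = f 0%N.
    apply: exists_rmorphism; first by [].
    split=> // f g; rewrite tmulE big_ord1 /= subnn.
    by rewrite (_ : tdiff 0 f = f) //; have [_ [_ [_ [_ [_ [-> _]]]]]] := HW.
  rewrite -evE -det_map_mx (_ : map_mx ev A = 1%:M) ?det1 //.
  by rewrite -(delta_mx0 HM He); apply/matrixP => a b; rewrite [LHS]mxE evE mxE.
have sdet : tshift (\det A) = \det A * th (\det P).
  rewrite -[LHS](sgE (\det A)) -det_map_mx.
  have -> : map_mx sg A = map_mx (@tshift _ _ _) A.
    by apply/matrixP => a b; rewrite !mxE sgE.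
  by rewrite taylor_mx_shift det_mulmx det_map_mx.
have iterdet i : exists2 y : L, y != 0 & iter i (@tshift _ _ _) (\det A) = \det A * th y.
  elim: i => [|i [y y0 IH]]; first by exists 1; rewrite ?oner_neq0 // rmorph1 mulr1.
  exists (\det P * sL y).
    apply: mulf_neq0 => //; apply: contra_neq y0 => sy0.
    by apply: (bij_inj HLb); rewrite sy0 (IDq_s_0 HL).
  have [_ [sM _]] := HW.
  by rewrite iterS IH sM sdet -th_s -mulrA -rmorphM.
have [i|g Ag] := @tunit _ _ _ (\det A).
  have [y y0 ->] := iterdet i; exists y^-1.
  rewrite tmulE big_ord1 /= subnn (_ : tdiff 0 _ = \det A); last first.
    by have [_ [_ [_ [_ [_ [-> _]]]]]] := HW.
  by rewrite detA0 mul1r thE HL0 mulfV.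
exists (g *: \adj A); split.
  by rewrite -scalemxAr mul_mx_adj -mul_scalar_mx -scalar_mxM mulrC Ag.
by rewrite -scalemxAl mul_adj_mx -mul_scalar_mx -scalar_mxM mulrC Ag.
Qed.

End TaylorSolution.

Lemma factor_rmorphism (A B T : comNzRingType) (h : {rmorphism A -> B})
    (k : {rmorphism A -> T}) :
    (forall y, exists x, h x = y) -> (forall x, h x = 0 -> k x = 0) ->
  exists u : {rmorphism B -> T}, forall x, u (h x) = k x.
Proof.
move=> /choice[g hg] hk.
have E x y : h x = h y -> k x = k y.
  move=> xy; apply/eqP; rewrite -subr_eq0 -rmorphB; apply/eqP/hk.
  by rewrite rmorphB xy subrr.
have [u uE] : exists u : {rmorphism B -> T}, forall y, u y = k (g y).
  apply: exists_rmorphism.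
    by move=> a b; rewrite -rmorphB; apply: E; rewrite rmorphB !hg.
  split; first by rewrite -(rmorph1 k); apply: E; rewrite hg rmorph1.
  by move=> a b; rewrite -rmorphM; apply: E; rewrite rmorphM !hg.
by exists u => x; rewrite uE; apply: E; rewrite hg.
Qed.

(** * A nonzero compositum of two extensions of L *)

Section Compositum.
Variable L : fieldType.

Definition linear_functional (R : comNzRingType) (j : {rmorphism L -> R})
    (lam : R -> L) : Prop :=
  (forall x y, lam (x + y) = lam x + lam y) /\ (forall l x, lam (j l * x) = l * lam x).

(** Modulo a subspace maximal among those missing 1, every x is congruent to exactly one scalar;
    this scalar is the value of the functional. No basis is chosen. *)
Lemma exists_functional (R : comNzRingType) (j : {rmorphism L -> R}) :
  exists lam, linear_functional j lam /\ lam 1 = 1.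
Proof.
have [||I [[I0 ID IM] I1 Imax]] :=
  @exists_maximal_stable R L (fun l x => j l * x) (fun x => x = 1).
- by move=> l; rewrite mulr0.
- by move/eqP; rewrite eq_sym oner_eq0.
have nI1 : ~ I 1 by move/I1; apply.
have IN x : I x -> I (- x) by move/(IM (-1)); rewrite rmorphN1 mulN1r.
have ex x : exists l, I (x - j l).
  have [Ix|nIx] := pselect (I x); first by exists 0; rewrite rmorph0 subr0.
  have [[y [l [Iy E]]]|nJ] := pselect (exists y l, I y /\ 1 = y + j l * x); last first.
    case: nIx; apply: (Imax (fun z => exists y l, I y /\ z = y + j l * x)).
    - split; first by exists 0, 0; rewrite rmorph0 mul0r addr0.
        move=> _ _ [y [l [Iy ->]]] [y' [l' [Iy' ->]]]; exists (y + y'), (l + l').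
        by split; [exact: ID|rewrite rmorphD; ring].
      move=> k _ [y [l [Iy ->]]]; exists (j k * y), (k * l).
      by split; [exact: IM|rewrite rmorphM; ring].
    - by move=> z Iz; exists z, 0; rewrite rmorph0 mul0r addr0.
    - by move=> z [y [l [Iy ->]]] z1; apply: nJ; exists y, l.
    - by exists 0, 1; rewrite rmorph1 mul1r add0r.
  have l0 : l != 0.
    by apply/eqP => l0; apply: nI1; rewrite E l0 rmorph0 mul0r addr0.
  exists l^-1; have -> : x - j l^-1 = j (- l^-1) * y.
    have -> : y = 1 - j l * x by rewrite [in RHS]E addrK.
    have jl : j l^-1 * j l = 1 by rewrite -rmorphM mulVf // rmorph1.
    transitivity (j l^-1 * j l * x - j l^-1); first by rewrite jl mul1r.
    by rewrite rmorphN; ring.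
  exact: IM.
have [lam lamE] := choice ex.
have uniq l l' x : I (x - j l) -> I (x - j l') -> l = l'.
  move=> Il /IN Il'; apply/eqP; rewrite -subr_eq0; apply/eqP; apply: contrapT => /eqP ll.
  apply: nI1; rewrite -(rmorph1 j) -(mulVf ll) rmorphM; apply: IM.
  have -> : j (l - l') = - ((x - j l) + - (x - j l')) by rewrite rmorphB; ring.
  by apply: IN; apply: ID.
exists lam; split; first split.
- move=> x y; apply: uniq (lamE (x + y)) _; rewrite rmorphD.
  have -> : x + y - (j (lam x) + j (lam y)) = (x - j (lam x)) + (y - j (lam y)) by ring.
  exact: ID.
- move=> l x; apply: uniq (lamE (j l * x)) _; rewrite rmorphM -mulrBr.
  exact: IM.
- by apply: uniq (lamE 1) _; rewrite rmorph1 subrr.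
Qed.

Variables (R1 R2 : comNzRingType) (j1 : {rmorphism L -> R1}) (j2 : {rmorphism L -> R2}).
Variable ys : seq R2.
Hypothesis gen : generated j2 ys.

Local Notation N := (size ys).
Let y (i : 'I_N) : R2 := ys`_i.

(** The map [lam] (x) id on polynomials: coefficients go to L by [lam], and the i-th variable to the
    i-th generator of R2. *)
Definition functional_eval (lam : R1 -> L) (p : {mpoly R1[N]}) : R2 :=
  \sum_(m <- msupp p) j2 (lam p@_m) * mmap1 y m.

Lemma functional_additive lam : linear_functional j1 lam ->
  exists g : {additive R1 -> R2}, forall x, g x = j2 (lam x).
Proof.
move=> [lamD _].
have gB : zmod_morphism (fun x => j2 (lam x)).
  by move=> a b; rewrite -rmorphB; congr (j2 _); apply: (addIr (lam b));
     rewrite -lamD !subrK.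
pose F := GRing.isZmodMorphism.Build R1 R2 (fun x => j2 (lam x)) gB.
pose g : {additive R1 -> R2} := HB.pack (fun x => j2 (lam x)) F.
by exists g.
Qed.

Lemma functional_eval_mmap lam (g : {additive R1 -> R2}) p :
  (forall x, g x = j2 (lam x)) -> functional_eval lam p = mmap g y p.
Proof. by move=> gE; apply: eq_bigr => m _; rewrite gE. Qed.

Lemma functional_eval_sum lam (I : Type) (s : seq I) (F : I -> {mpoly R1[N]}) :
  linear_functional j1 lam ->
  functional_eval lam (\sum_(i <- s) F i) = \sum_(i <- s) functional_eval lam (F i).
Proof.
move=> /functional_additive[g gE]; rewrite (functional_eval_mmap _ gE) raddf_sum.
by apply: eq_bigr => i _; rewrite (functional_eval_mmap _ gE).
Qed.

Lemma functional_evalX lam c m : linear_functional j1 lam ->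
  functional_eval lam (c *: 'X_[m]) = j2 (lam c) * mmap1 y m.
Proof.
move=> /functional_additive[g gE]; rewrite /functional_eval.
have [->|c0] := eqVneq c 0; first by rewrite scale0r msupp0 big_nil -gE raddf0 mul0r.
by rewrite msuppMCX // big_seq1 mcoeffZ mcoeffX eqxx mulr1.
Qed.

Lemma functional_evalM lam c m p : linear_functional j1 lam ->
  functional_eval lam (c *: 'X_[m] * p) =
  functional_eval (fun x => lam (c * x)) p * mmap1 y m.
Proof.
move=> Llam; rewrite {1}[p]mpolyE mulr_sumr functional_eval_sum // mulr_suml.
apply: eq_bigr => m' _.
rewrite -scalerAl -scalerAr scalerA -mpolyXD functional_evalX // commr_mmap1_M.
  by rewrite -mulrA [_ * mmap1 y m]mulrC.
by move=> i x; apply: mulrC.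
Qed.

(* The kernel of R1[X_1, ..., X_N] -> R1 (x)_L R2, tested against the functionals of R1:
   this makes the quotient visibly nonzero. *)
Definition tensor_ideal (p : {mpoly R1[N]}) : Prop :=
  forall lam, linear_functional j1 lam -> functional_eval lam p = 0.

(** Closed under multiplication because x |-> lam (c x) is again a functional for every c in R1. *)
Lemma tensor_ideal_ideal : is_ideal tensor_ideal.
Proof.
have ID p p' : tensor_ideal p -> tensor_ideal p' -> tensor_ideal (p + p').
  move=> Jp Jp' lam Llam; have [g gE] := functional_additive Llam.
  rewrite (functional_eval_mmap _ gE) mmapD -!(functional_eval_mmap _ gE).
  by rewrite Jp // Jp' // addr0.
have I0 : tensor_ideal 0.
  by move=> lam Llam; rewrite /functional_eval msupp0 big_nil.
split=> //; split=> // r p Jp; rewrite [r]mpolyE mulr_suml.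
elim/big_ind: _ => // m _ lam [lamD lamZ].
rewrite functional_evalM // Jp ?mul0r //; split.
  by move=> a b; rewrite mulrDr lamD.
by move=> l a; rewrite mulrCA lamZ.
Qed.

Lemma exists_compositum : exists (T : comNzRingType) (u1 : {rmorphism R1 -> T})
  (u2 : {rmorphism R2 -> T}), forall l, u1 (j1 l) = u2 (j2 l).
Proof.
have [lam [Llam lam1]] := exists_functional j1.
have [|T [p [p_surj p0]]] := exists_quotient tensor_ideal_ideal.
  move=> /(_ lam Llam); have [g gE] := functional_additive Llam.
  rewrite (functional_eval_mmap _ gE) -mpolyC1 mmapC gE lam1 rmorph1.
  by move/eqP; rewrite oner_eq0.
pose h : {rmorphism {mpoly L[N]} -> R2} := mmap j2 y.
pose k : {rmorphism {mpoly L[N]} -> {mpoly R1[N]}} := map_mpoly j1.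
have h_surj z : exists f, h f = z.
  apply: (gen (S := fun z => exists f, h f = z)).
  - by move=> a; exists a%:MP; apply: mmapC.
  - by move=> _ _ [f <-] [f' <-]; exists (f + f'); rewrite rmorphD.
  - by move=> _ _ [f <-] [f' <-]; exists (f * f'); rewrite rmorphM.
  - move=> v vys; have iv : (index v ys < N)%N by rewrite index_mem.
    exists 'X_(Ordinal iv); rewrite /h /= mmapX mmap1U /y /= nth_index //.
(* On polynomials f over L the functional acts as multiplication by lam(1), so the relations of R2
   lie in the ideal. *)
have [|u2 u2E] := @factor_rmorphism _ _ _ h (p \o k) h_surj.
  move=> f hf; apply/p0 => mu Lmu.
  have -> : k f = \sum_(m <- msupp f) j1 f@_m *: 'X_[m].
    rewrite {1}[f]mpolyE rmorph_sum; apply: eq_bigr => m _.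
    by rewrite /k /= map_mpolyZ map_mpolyX.
  rewrite functional_eval_sum //; transitivity (j2 (mu 1) * h f); last by rewrite hf mulr0.
  rewrite /h /= /mmap mulr_sumr; apply: eq_bigr => m _.
  by rewrite functional_evalX // -[j1 _]mulr1 Lmu.2 rmorphM mulrAC mulrC mulrA.
pose cst : {rmorphism R1 -> {mpoly R1[N]}} := @mpolyC N R1.
exists T, (p \o cst), u2 => l /=.
have -> : j2 l = h l%:MP by rewrite /h /= mmapC.
by rewrite u2E /k /= map_mpolyC.
Qed.

End Compositum.

(** * Matrix entries and stable generated subrings *)

Definition mx_entries (R : Type) (r : nat) (A : 'M[R]_r) : seq R :=
  [seq A a b | a <- enum 'I_r, b <- enum 'I_r].

Lemma mem_mx_entries (R : eqType) (r : nat) (A : 'M[R]_r) a b : A a b \in mx_entries A.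
Proof. by apply/allpairsP; exists (a, b); rewrite !mem_enum. Qed.

Lemma mx_entriesP (R : eqType) (r : nat) (A : 'M[R]_r) x :
  x \in mx_entries A -> exists a b, x = A a b.
Proof. by case/allpairsP => -[a b] [_ _ ->]; exists a, b. Qed.

Lemma det_closed (R : comNzRingType) (S : R -> Prop) (r : nat) (A : 'M[R]_r) :
    S 1 -> S (-1) -> (forall x y, S x -> S y -> S (x + y)) ->
    (forall x y, S x -> S y -> S (x * y)) -> (forall a b, S (A a b)) ->
  S (\det A).
Proof.
move=> S1 SN SD SM SA; have S0 : S 0 by rewrite -(subrr 1); apply: SD.
apply: big_ind => // g _; apply: (SM).
  by move: (X in (-1) ^+ X) => k; elim: k => // k IH; rewrite exprS; apply: SM.
by apply: big_ind.
Qed.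

Definition subring_gen (R : pzRingType) (B : R -> Prop) (x : R) : Prop :=
  forall S : R -> Prop, is_subring S -> (forall y, B y -> S y) -> S x.

Lemma subring_gen_ring (R : pzRingType) (B : R -> Prop) : is_subring (subring_gen B).
Proof.
split=> [S [S1 SB SM] BS //|x y Sx Sy S HS BS|x y Sx Sy S HS BS].
  by have [_ SB _] := HS; apply: SB; [apply: Sx|apply: Sy].
by have [_ _ SM] := HS; apply: SM; [apply: Sx|apply: Sy].
Qed.

Lemma subring_gen_base (R : pzRingType) (B : R -> Prop) x : B x -> subring_gen B x.
Proof. by move=> Bx S _; apply. Qed.

Lemma is_subringD (R : pzRingType) (S : R -> Prop) :
  is_subring S -> [/\ S 0, forall x, S x -> S (- x) & forall x y, S x -> S y -> S (x + y)].
Proof.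
move=> [S1 SB SM]; have S0 : S 0 by rewrite -(subrr 1); apply: SB.
have SN x : S x -> S (- x) by rewrite -sub0r; apply: SB.
by split=> // x y Sx Sy; rewrite -[y]opprK; apply: SB => //; apply: SN.
Qed.

Lemma is_subring_sum (R : pzRingType) (S : R -> Prop) (I : Type) (l : seq I) (P : pred I)
  (F : I -> R) : is_subring S -> (forall i, P i -> S (F i)) -> S (\sum_(i <- l | P i) F i).
Proof. by move=> /is_subringD[S0 _ SD] SF; apply: big_ind. Qed.

Section SubringGenStable.
Variables (C : closedFieldType) (q : C).
Variables (W : comNzRingType) (iW : {rmorphism Ct C -> W}) (s : W -> W) (d : nat -> W -> W).
Hypothesis HW : IDq_ring q iW s d.
Variable B : W -> Prop.
Hypothesis Bs : forall x, B x -> subring_gen B (s x).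

Lemma subring_gen_shift x : subring_gen B x -> subring_gen B (s x).
Proof.
have [S1 SB SM] := subring_gen_ring B.
have [sD [sM [s1 _]]] := HW.
move=> Sx; apply: (Sx (fun x => subring_gen B (s x))) => //.
split=> [|y z Sy Sz|y z Sy Sz]; first by rewrite s1.
  have -> : s (y - z) = s y - s z by apply: (addIr (s z)); rewrite -sD !subrK.
  exact: SB.
by rewrite sM; apply: SM.
Qed.

Hypothesis Bd : forall k x, B x -> subring_gen B (d k x).

(** The elements all of whose delta^(k) lie in the generated subring form a subring themselves, by
    the Leibniz rule and stability under the shift. *)
Lemma subring_gen_diff k x : subring_gen B x -> subring_gen B (d k x).
Proof.
have ringS := subring_gen_ring B; have [S1 SB SM] := ringS.
have [S0 _ _] := is_subringD ringS.
have [_ [_ [_ [_ [_ [d0 [_ [dD [dM _]]]]]]]]] := HW.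
have iterS i y : subring_gen B y -> subring_gen B (iter i s y).
  by move=> Sy; elim: i => //= i; apply: subring_gen_shift.
move=> Sx; move: k; apply: (Sx (fun x => forall k, subring_gen B (d k x))); last first.
  by move=> y By k; apply: Bd.
split=> [k|y z Sy Sz k|y z Sy Sz k].
- by case: k => [|k]; rewrite ?d0 ?(IDq_d_1 HW).
- by rewrite dD (IDq_dN HW); apply: SB.
- by rewrite dM; apply: is_subring_sum => // i _; apply: SM => //; apply: iterS.
Qed.

End SubringGenStable.

(** * Comparison of solutions in a common simple ring *)

Section PicardVessiot.
Variables (C : closedFieldType) (n : nat) (q : C).
Hypotheses (n_gt1 : (2 <= n)%N) (q_prim : n.-primitive_root q).
Variables (L : fieldType) (iL : {rmorphism Ct C -> L}) (sL : L -> L) (dL : nat -> L -> L).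
Hypothesis HL : IDq_field_algclosed_consts q iL sL dL.
Variable r : nat.
Variable G : nat -> 'M[L]_r.
Hypothesis G0 : G 0%N = 1%:M.

Lemma constant_matrix (T : comNzRingType) (j : {rmorphism L -> T}) (s : T -> T)
    (d : nat -> T -> T) (ys : seq T) (A : 'M[T]_r) :
    IDq_ext q iL sL dL j s d -> IDq_simple d -> generated j ys ->
    (forall a b, is_const d 0 (A a b)) ->
  exists B, map_mx j B = A.
Proof.
move=> HT simT gen cA.
have /choice[f fE] : forall ab : 'I_r * 'I_r, exists l, j l = A ab.1 ab.2.
  move=> [a b] /=.
  have [l _ <-] := constants_finitely_generated n_gt1 q_prim HL HT simT gen (cA a b).
  by exists l.
by exists (\matrix_(a, b) f (a, b)); apply/matrixP => a b; rewrite !mxE fE.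
Qed.

(** The ratios g = Y1^-1 Y2 and h = Y2^-1 Y1 in T have constant entries, hence come from L. So Y2 =
    Y1 g and Z2 = h Z1 have their entries in the image of R1. *)
Lemma solution_range (T : comNzRingType) (j : {rmorphism L -> T}) (s : T -> T)
    (d : nat -> T -> T) (ys : seq T)
    (R1 R2 : comNzRingType) (j1 : {rmorphism L -> R1}) (j2 : {rmorphism L -> R2})
    (f1 : {rmorphism R1 -> T}) (f2 : {rmorphism R2 -> T})
    (Y1 Z1 : 'M[R1]_r) (Y2 Z2 : 'M[R2]_r) :
    IDq_ext q iL sL dL j s d -> IDq_simple d -> generated j ys ->
    (forall l, f1 (j1 l) = j l) -> (forall l, f2 (j2 l) = j l) ->
    Y1 *m Z1 = 1%:M -> Z1 *m Y1 = 1%:M -> Y2 *m Z2 = 1%:M -> Z2 *m Y2 = 1%:M ->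
    fundamental s d (fun k => map_mx j (G k)) (map_mx f1 Y1) ->
    fundamental s d (fun k => map_mx j (G k)) (map_mx f2 Y2) ->
    generated j2 (mx_entries Y2 ++ mx_entries Z2) ->
  forall x, exists y, f1 y = f2 x.
Proof.
move=> HT simT gen fj1 fj2 YZ1 ZY1 YZ2 ZY2 F1 F2 gen2.
have [HTr _] := HT.
have jG0 : map_mx j (G 0%N) = 1%:M by rewrite G0 map_mx1.
have fYZ1 : map_mx f1 Y1 *m map_mx f1 Z1 = 1%:M by rewrite -map_mxM YZ1 map_mx1.
have fZY1 : map_mx f1 Z1 *m map_mx f1 Y1 = 1%:M by rewrite -map_mxM ZY1 map_mx1.
have fYZ2 : map_mx f2 Y2 *m map_mx f2 Z2 = 1%:M by rewrite -map_mxM YZ2 map_mx1.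
have fZY2 : map_mx f2 Z2 *m map_mx f2 Y2 = 1%:M by rewrite -map_mxM ZY2 map_mx1.
have [g gE] := constant_matrix HT simT gen
  (fundamental_ratio n_gt1 q_prim HTr jG0 F1 F2 fYZ1 fZY1).
have [h hE] := constant_matrix HT simT gen
  (fundamental_ratio n_gt1 q_prim HTr jG0 F2 F1 fYZ2 fZY2).
have jE B : map_mx j B = map_mx f1 (map_mx j1 B).
  by apply/matrixP => a b; rewrite !mxE fj1.
have YE : map_mx f2 Y2 = map_mx f1 (Y1 *m map_mx j1 g).
  by rewrite map_mxM -jE gE mulmxA fYZ1 mul1mx.
have ZE : map_mx f2 Z2 = map_mx f1 (map_mx j1 h *m Z1).
  by rewrite map_mxM -jE hE -mulmxA fYZ1 mulmx1.
apply: gen2 => [l|x y [x' Ex] [y' Ey]|x y [x' Ex] [y' Ey]|x].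
- by exists (j1 l); rewrite fj1 fj2.
- by exists (x' + y'); rewrite !rmorphD Ex Ey.
- by exists (x' * y'); rewrite !rmorphM Ex Ey.
- rewrite mem_cat => /orP[] /mx_entriesP[a [b ->]].
    by exists ((Y1 *m map_mx j1 g) a b); move/matrixP: YE => /(_ a b); rewrite mxE [RHS]mxE.
  by exists ((map_mx j1 h *m Z1) a b); move/matrixP: ZE => /(_ a b); rewrite mxE [RHS]mxE.
Qed.

End PicardVessiot.

(** * Uniqueness *)

Section Uniqueness.
Variables (C : closedFieldType) (n : nat) (q : C).
Hypotheses (n_gt1 : (2 <= n)%N) (q_prim : n.-primitive_root q).
Variables (L : fieldType) (iL : {rmorphism Ct C -> L}) (sL : L -> L) (dL : nat -> L -> L).
Hypothesis HL : IDq_field_algclosed_consts q iL sL dL.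
Variables (M : vectType L) (dM : nat -> M -> M).
Hypothesis HM : IDq_module q iL sL dL dM.
Variable e : (\dim (fullv : {vspace M})).-tuple M.
Hypothesis He : basis_of fullv e.

Local Notation r := (\dim (fullv : {vspace M})).
Local Notation G := (Defs.delta_mx dM e).

(** Gives a finite list of generators: the inverse of det Y is det Z, a polynomial in the entries of
    Z. *)
Lemma PV_generated (R : comNzRingType) (j : {rmorphism L -> R}) s d (Y Z : 'M[R]_r) :
    IDq_PV_ring q iL sL dL dM e j s d Y -> Y *m Z = 1%:M ->
  generated j (mx_entries Y ++ mx_entries Z).
Proof.
move=> [_ [_ [_ [_ [gen _]]]]] YZ S Sj SD SM Sys; apply: gen => //.
  by move=> a b; apply: Sys; rewrite mem_cat mem_mx_entries.
move=> u udet; have -> : u = \det Z.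
  by rewrite -[LHS]mulr1 -(det1 R r) -YZ det_mulmx mulrA udet mul1r.
apply: det_closed => //; first by rewrite -(rmorph1 j).
  by rewrite -(rmorphN1 j).
by move=> a b; apply: Sys; rewrite mem_cat mem_mx_entries orbT.
Qed.

Lemma IDq_morphism_injective (R T : comNzRingType) (f : {rmorphism R -> T})
    (d : nat -> R -> R) (d' : nat -> T -> T) :
    IDq_simple d -> (forall k x, f (d k x) = d' k (f x)) -> (forall k, d' k 0 = 0) ->
  injective f.
Proof.
move=> simR fd d'0; apply: raddf_inj => x fx.
have [||I0|I1] := simR (fun x => f x = 0).
- split; first exact: rmorph0.
  split; first by move=> a b fa fb; rewrite rmorphD fa fb addr0.
  by move=> a b fb; rewrite rmorphM fb mulr0.
- by move=> k y fy; rewrite fd fy d'0.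
- exact: I0.
- by have /eqP := I1 1; rewrite rmorph1 oner_eq0.
Qed.

Lemma fundamental_map (R T : comNzRingType) (f : {rmorphism R -> T}) s d s' d' (m : nat)
    (H : nat -> 'M[R]_m) (Y0 : 'M[R]_m) :
    (forall x, f (s x) = s' (f x)) -> (forall k x, f (d k x) = d' k (f x)) ->
    fundamental s d H Y0 ->
  fundamental s' d' (fun k => map_mx f (H k)) (map_mx f Y0).
Proof.
move=> fs fd FY k k0; have := congr1 (map_mx f) (FY k k0).
rewrite map_mx0 => E; rewrite -[RHS]E (big_morph (map_mx f) (@map_mxD _ _ f m m) (map_mx0 f _ _)).
apply: eq_bigr => i _; rewrite map_mxM; congr (_ *m _).
by apply/matrixP => a b; rewrite !mxE (iter_morph _ _ fs) fd.
Qed.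

Lemma PV_fundamental (R : comNzRingType) (j : {rmorphism L -> R}) s d (Y : 'M[R]_r) :
    IDq_PV_ring q iL sL dL dM e j s d Y ->
  fundamental s d (fun k => map_mx j (G k)) Y.
Proof. by move=> [_ [_ [_ [F _]]]]. Qed.

Lemma IDq_PV_unique (R1 : comNzRingType) (j1 : {rmorphism L -> R1}) (s1 : R1 -> R1)
    (d1 : nat -> R1 -> R1) (Y1 : 'M[R1]_r)
    (R2 : comNzRingType) (j2 : {rmorphism L -> R2}) (s2 : R2 -> R2)
    (d2 : nat -> R2 -> R2) (Y2 : 'M[R2]_r) :
    IDq_PV_ring q iL sL dL dM e j1 s1 d1 Y1 ->
    IDq_PV_ring q iL sL dL dM e j2 s2 d2 Y2 ->
  exists phi : {rmorphism R1 -> R2},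
    [/\ bijective phi, (forall l, phi (j1 l) = j2 l) &
        (forall k x, phi (d1 k x) = d2 k (phi x))].
Proof.
move=> PV1 PV2.
have [[Hr1 [sj1 dj1]] [sim1 [[Z1 [YZ1 ZY1]] _]]] := PV1.
have [[Hr2 [sj2 dj2]] [sim2 [[Z2 [YZ2 ZY2]] _]]] := PV2.
have gen1 := PV_generated PV1 YZ1; have gen2 := PV_generated PV2 YZ2.
have F1 := PV_fundamental PV1; have F2 := PV_fundamental PV2.
have [Om [u1 [u2 u12]]] := exists_compositum j1 gen2.
pose q' := u1 (j1 (iL (cF q))); pose t' := u1 (j1 (iL (tF C))).
have [th1 [th1E th1s th1d HW]] := exists_taylor n_gt1 q_prim Hr1 (u := u1)
  (q' := q') (t' := t') erefl erefl.
have [th2 [th2E th2s th2d _]] := exists_taylor n_gt1 q_prim Hr2 (u := u2)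
  (q' := q') (t' := t') (esym (u12 _)) (esym (u12 _)).
have th12 l : th1 (j1 l) = th2 (j2 l).
  by apply/funext => k; rewrite th1E th2E dj1 dj2 u12.
(* Only the subring generated by both images is used; its quotient T stays finitely generated over L
   and so has no new constants. *)
pose B w := (exists x, th1 x = w) \/ (exists x, th2 x = w).
have Bs w : B w -> subring_gen B (tshift w).
  move=> Bw; apply: subring_gen_base; case: Bw => -[x <-].
    by left; exists (s1 x); rewrite th1s.
  by right; exists (s2 x); rewrite th2s.
have Bd k w : B w -> subring_gen B (tdiff k w).
  move=> Bw; apply: subring_gen_base; case: Bw => -[x <-].
    by left; exists (d1 k x); rewrite th1d.
  by right; exists (d2 k x); rewrite th2d.
have sn : forall w, iter n (@tshift _ q' t') w = w.
  move=> w; apply: iter_tshift_id.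
  by rewrite /q' -(rmorphXn u1) (IDq_Qn q_prim (j1 \o iL)) rmorph1.
have [T0 [T [i [p [s0 [d0 [s' [d' [[i_inj iS p_surj simT] [is0 id0 ps0 pd0 HT]]]]]]]]]] :=
  exists_simple_subquotient n_gt1 q_prim HW sn (subring_gen_ring B)
    (fun f => subring_gen_base (or_introl (ex_intro _ _ erefl)))
    (subring_gen_shift HW Bs) (subring_gen_diff HW Bs Bd).
have [k1 k1E] : exists k1 : {rmorphism R1 -> T0}, forall x, i (k1 x) = th1 x.
  by apply: lift_rmorphism => // x; apply/iS; apply: subring_gen_base; left; exists x.
have [k2 k2E] : exists k2 : {rmorphism R2 -> T0}, forall x, i (k2 x) = th2 x.
  by apply: lift_rmorphism => // x; apply/iS; apply: subring_gen_base; right; exists x.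
pose f1 : {rmorphism R1 -> T} := p \o k1; pose f2 : {rmorphism R2 -> T} := p \o k2.
have f1s x : f1 (s1 x) = s' (f1 x).
  by rewrite /f1 /= -ps0; congr (p _); apply: i_inj; rewrite is0 !k1E th1s.
have f2s x : f2 (s2 x) = s' (f2 x).
  by rewrite /f2 /= -ps0; congr (p _); apply: i_inj; rewrite is0 !k2E th2s.
have f1d k x : f1 (d1 k x) = d' k (f1 x).
  by rewrite /f1 /= -pd0; congr (p _); apply: i_inj; rewrite id0 !k1E th1d.
have f2d k x : f2 (d2 k x) = d' k (f2 x).
  by rewrite /f2 /= -pd0; congr (p _); apply: i_inj; rewrite id0 !k2E th2d.
pose j : {rmorphism L -> T} := f1 \o j1.
have fj1 l : f1 (j1 l) = j l by [].
have fj2 l : f2 (j2 l) = j l.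
  by rewrite /j /f1 /f2 /=; congr (p _); apply: i_inj; rewrite k1E k2E th12.
have HTr : IDq_ring q (j \o iL) s' d'.
  by apply: IDq_ring_ext (HT (k1 \o (j1 \o iL)) _) => // x; rewrite /= k1E.
have HTe : IDq_ext q iL sL dL j s' d'.
  split=> //; split=> [a|k a]; first by rewrite -!fj1 -f1s sj1.
  by rewrite -!fj1 -f1d dj1.
have genT : generated j (map f1 (mx_entries Y1 ++ mx_entries Z1) ++
                         map f2 (mx_entries Y2 ++ mx_entries Z2)).
  move=> S Sj SD SM Sys.
  have S1x x : S (f1 x).
    apply: (gen1 (fun x => S (f1 x))) => [l|y z|y z|y yY].
    - by rewrite fj1.
    - by rewrite rmorphD; apply: SD.
    - by rewrite rmorphM; apply: SM.
    - by apply: Sys; rewrite mem_cat map_f.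
  have S2x x : S (f2 x).
    apply: (gen2 (fun x => S (f2 x))) => [l|y z|y z|y yY].
    - by rewrite fj2.
    - by rewrite rmorphD; apply: SD.
    - by rewrite rmorphM; apply: SM.
    - by apply: Sys; rewrite mem_cat orbC map_f.
  move=> x; have [x0 <-] := p_surj x.
  have /iS ix0 : exists y, i y = i x0 by exists x0.
  (* Membership in the generated subring serves as an induction principle, applied to the elements
     of W with a preimage in T0 whose class in T satisfies S. *)
  have [||x1 [/i_inj <- //]] := ix0 (fun w => exists x1, i x1 = w /\ S (p x1)).
  - split; first by exists 1; rewrite !rmorph1 -(rmorph1 j).
      move=> _ _ [x1 [<- Sx1]] [x2 [<- Sx2]]; exists (x1 - x2); rewrite !rmorphB.
      split=> //; apply: SD => //; rewrite -mulN1r -(rmorphN1 j).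
      exact: SM.
    move=> _ _ [x1 [<- Sx1]] [x2 [<- Sx2]]; exists (x1 * x2); rewrite !rmorphM.
    by split=> //; apply: SM.
  - by move=> _ [] [x1 <-]; [exists (k1 x1); split=> //; exact: S1x|
                             exists (k2 x1); split=> //; exact: S2x].
have d'0 k : d' k 0 = 0 by apply: (IDq_d_0 HTr).
(* Simplicity of R1 and R2 makes both maps to T embeddings; their images coincide by
   [solution_range] used in both directions. *)
have f1_inj := IDq_morphism_injective sim1 f1d d'0.
have f2_inj := IDq_morphism_injective sim2 f2d d'0.
have jG (R : comNzRingType) (h : {rmorphism R -> T}) (jR : {rmorphism L -> R}) :
    (forall l, h (jR l) = j l) -> (fun k => map_mx h (map_mx jR (G k))) =
    (fun k => map_mx j (G k)).
  move=> hj; apply/funext => k; apply/matrixP => a b.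
  by rewrite mxE [X in h X]mxE hj [RHS]mxE.
have FT1 := fundamental_map f1s f1d F1; rewrite (jG _ _ _ fj1) in FT1.
have FT2 := fundamental_map f2s f2d F2; rewrite (jG _ _ _ fj2) in FT2.
have G0 := delta_mx0 HM He.
have range12 x : exists y, f2 y = f1 x.
  exact: (solution_range n_gt1 q_prim HL G0 HTe simT genT fj2 fj1 YZ2 ZY2 YZ1 ZY1).
have range21 x : exists y, f1 y = f2 x.
  exact: (solution_range n_gt1 q_prim HL G0 HTe simT genT fj1 fj2 YZ1 ZY1 YZ2 ZY2).
have [phi phiE] := lift_rmorphism f2_inj range12.
have [psi psiE] := lift_rmorphism f1_inj range21.
exists phi; split.
- exists psi => x; first by apply: f1_inj; rewrite psiE phiE.
  by apply: f2_inj; rewrite phiE psiE.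
- by move=> l; apply: f2_inj; rewrite phiE fj2.
- by move=> k x; apply: f2_inj; rewrite phiE f1d f2d phiE.
Qed.

End Uniqueness.

(** * Existence *)

Section Existence.
Variables (C : closedFieldType) (n : nat) (q : C).
Hypotheses (n_gt1 : (2 <= n)%N) (q_prim : n.-primitive_root q).
Variables (L : fieldType) (iL : {rmorphism Ct C -> L}) (sL : L -> L) (dL : nat -> L -> L).
Hypothesis HL : IDq_field_algclosed_consts q iL sL dL.
Variables (M : vectType L) (dM : nat -> M -> M).
Hypothesis HM : IDq_module q iL sL dL dM.
Variable e : (\dim (fullv : {vspace M})).-tuple M.
Hypothesis He : basis_of fullv e.

Local Notation r := (\dim (fullv : {vspace M})).
Local Notation G := (Defs.delta_mx dM e).

Lemma IDq_PV_exists :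
  exists (R : comNzRingType) (j : {rmorphism L -> R}) (s : R -> R)
         (d : nat -> R -> R) (Y : 'M[R]_r),
    IDq_PV_ring q iL sL dL dM e j s d Y.
Proof.
have [HLr _] := HL.
have [th [thE ths thd HW]] := exists_taylor n_gt1 q_prim HLr (u := idfun)
  (q' := iL (cF q)) (t' := iL (tF C)) erefl erefl.
pose W := qtaylor (iL (cF q)) (iL (tF C)).
pose A : 'M[W]_r := taylor_mx q iL dM e.
have [Y [AY YA]] : exists Y : 'M[W]_r, A *m Y = 1%:M /\ Y *m A = 1%:M :=
  taylor_mx_unit n_gt1 q_prim HLr HM He thE ths thd HW.
have Ad k : map_mx (@tdiff _ _ _ k) A = A *m map_mx th (G k) :=
  taylor_mx_d HLr HM He thE ths thd k.
have As : map_mx (@tshift _ _ _) A = A *m map_mx th (frobenius_mx q iL dM e) :=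
  taylor_mx_shift n_gt1 q_prim HLr HM He thE ths thd HW.
have [X [PX XP]] := frobenius_mx_unit n_gt1 q_prim HLr HM He.
have FY := fundamental_inverse HW Ad AY YA.
have Ys : map_mx (@tshift _ _ _) Y = map_mx th X *m Y.
  have [_ [sM _]] := HW.
  have sAY : map_mx (@tshift _ _ _) A *m map_mx (@tshift _ _ _) Y = 1%:M :> 'M[W]_r.
    by have := map_iter_mul HW 1 A Y; rewrite AY (map_iter_1 HW r 1).
  rewrite -[RHS]mulmx1 -sAY As !mulmxA -[map_mx th X *m Y *m A]mulmxA YA mulmx1.
  by rewrite -map_mxM XP map_mx1 mul1mx.
(* The entries of A = Y^-1 are included so that Y stays invertible in the subring and in its
   quotient. *)
pose B w := [\/ exists l, th l = w, exists a b, Y a b = w | exists a b, A a b = w].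
have SB := subring_gen_base (B := B).
have ringS := subring_gen_ring B; have [_ _ SM] := ringS.
have [S0 SN SD] := is_subringD ringS.
have Sth l : subring_gen B (th l) by apply: SB; constructor 1; exists l.
have SY a b : subring_gen B (Y a b) by apply: SB; constructor 2; exists a, b.
have SA a b : subring_gen B (A a b) by apply: SB; constructor 3; exists a, b.
have Smul (U V : 'M[W]_r) : (forall a b, subring_gen B (U a b)) ->
    (forall a b, subring_gen B (V a b)) -> forall a b, subring_gen B ((U *m V) a b).
  by move=> SU SV a b; rewrite mxE; apply: is_subring_sum => // c _; apply: SM.
have Smth (U : 'M[L]_r) a b : subring_gen B ((map_mx th U) a b) by rewrite mxE.
have Bs w : B w -> subring_gen B (tshift w).
  case=> [[l <-]|[a [b <-]]|[a [b <-]]].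
  - by rewrite -ths.
  - by have /matrixP/(_ a b) := Ys; rewrite [LHS]mxE => ->; apply: Smul.
  - by have /matrixP/(_ a b) := As; rewrite [LHS]mxE => ->; apply: Smul.
have Ss := subring_gen_shift HW Bs.
have Yd k : forall a b, subring_gen B (tdiff k (Y a b)).
  elim/ltn_ind: k => k IH a b.
  case: k IH => [|k] IH.
    by have [_ [_ [_ [_ [_ [-> _]]]]]] := HW.
  (* As G_0 = 1, the equation expresses the operator of order k + 1 on Y through operators of lower
     order, so the induction hypothesis applies. *)
  have := FY k.+1 isT; rewrite big_ord_recl /= (delta_mx0 HM He) map_mx1 mul1mx subn0.
  move=> /eqP; rewrite addr_eq0 => /eqP /matrixP /(_ a b); rewrite !mxE /= => ->.
  apply: SN; rewrite summxE; apply: is_subring_sum => // i _.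
  apply: Smul => // a' b'; rewrite !mxE.
  have : forall l w, subring_gen B w -> subring_gen B (iter l (@tshift _ _ _) w).
    by move=> l w Sw; elim: l => //= l; apply: Ss.
  by apply; apply: IH; rewrite /bump /=; have := ltn_ord i; lia.
have Bd k w : B w -> subring_gen B (tdiff k w).
  case=> [[l <-]|[a [b <-]]|[a [b <-]]].
  - by rewrite -thd.
  - exact: Yd.
  - by have /matrixP/(_ a b) := Ad k; rewrite [LHS]mxE => ->; apply: Smul.
have sn w : iter n (@tshift _ (iL (cF q)) (iL (tF C))) w = w.
  apply: iter_tshift_id; exact: (IDq_Qn q_prim iL).
have [T0 [T [i [p [s0 [d0 [s' [d' [[i_inj iS p_surj simT] [is0 id0 ps0 pd0 HT]]]]]]]]]] :=
  exists_simple_subquotient n_gt1 q_prim HW sn ringS (fun f => Sth (iL f)) Ss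
    (subring_gen_diff HW Bs Bd).
have [k kE] : exists k : {rmorphism L -> T0}, forall x, i (k x) = th x.
  by apply: lift_rmorphism => // x; apply/iS.
have liftmx (U : 'M[W]_r) : (forall a b, subring_gen B (U a b)) ->
    exists U0 : 'M[T0]_r, map_mx i U0 = U.
  move=> SU; have /choice[f fE] : forall ab : 'I_r * 'I_r, exists y, i y = U ab.1 ab.2.
    by move=> ab; apply/iS.
  by exists (\matrix_(a, b) f (a, b)); apply/matrixP => a b; rewrite !mxE fE.
have [Y0 Y0E] := liftmx Y SY; have [A0 A0E] := liftmx A SA.
have mxi_inj (U V : 'M[T0]_r) : map_mx i U = map_mx i V -> U = V.
  by move=> UV; apply/matrixP => a b; apply: i_inj; move/matrixP: UV => /(_ a b); rewrite !mxE.
have AY0 : A0 *m Y0 = 1%:M by apply: mxi_inj; rewrite map_mxM A0E Y0E AY map_mx1.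
have YA0 : Y0 *m A0 = 1%:M by apply: mxi_inj; rewrite map_mxM A0E Y0E YA map_mx1.
pose j : {rmorphism L -> T} := p \o k.
have HTr : IDq_ring q (j \o iL) s' d'.
  by apply: IDq_ring_ext (HT (k \o iL) _) => // x; rewrite /= kE.
have HTe : IDq_ext q iL sL dL j s' d'.
  split=> //; split=> [a|l a]; rewrite /j /=.
    by rewrite -ps0; congr (p _); apply: i_inj; rewrite is0 !kE ths.
  by rewrite -pd0; congr (p _); apply: i_inj; rewrite id0 !kE thd.
pose Y' := map_mx p Y0; pose A' := map_mx p A0.
have AY' : A' *m Y' = 1%:M by rewrite -map_mxM AY0 map_mx1.
have YA' : Y' *m A' = 1%:M by rewrite -map_mxM YA0 map_mx1.
have genT (S : T -> Prop) : (forall l, S (j l)) -> (forall x y, S x -> S y -> S (x + y)) ->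
    (forall x y, S x -> S y -> S (x * y)) -> (forall a b, S (Y' a b)) ->
    (forall a b, S (A' a b)) -> forall x, S x.
  move=> Sj SD' SM' SY' SA' x; have [x0 <-] := p_surj x.
  have /iS ix0 : exists y, i y = i x0 by exists x0.
  have [||x1 [/i_inj <- //]] := ix0 (fun w => exists x1, i x1 = w /\ S (p x1)).
  - split; first by exists 1; rewrite !rmorph1 -(rmorph1 j).
      move=> _ _ [x1 [<- Sx1]] [x2 [<- Sx2]]; exists (x1 - x2); rewrite !rmorphB.
      split=> //; apply: (SD') => //; rewrite -mulN1r -(rmorphN1 j).
      exact: SM'.
    move=> _ _ [x1 [<- Sx1]] [x2 [<- Sx2]]; exists (x1 * x2); rewrite !rmorphM.
    by split=> //; apply: (SM').
  - move=> _ [[l <-]|[a [b <-]]|[a [b <-]]].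
    + by exists (k l); split=> //; apply: Sj.
    + by exists (Y0 a b); rewrite -Y0E mxE; split=> //; have := SY' a b; rewrite mxE.
    + by exists (A0 a b); rewrite -A0E mxE; split=> //; have := SA' a b; rewrite mxE.
exists T, j, s', d', Y'; split=> //; split=> //; split; first by exists A'.
split.
  have F0 : fundamental s0 d0 (fun l => map_mx k (G l)) Y0.
    move=> l l0; apply: mxi_inj; rewrite map_mx0 -[RHS](FY l l0).
    rewrite (big_morph (map_mx i) (@map_mxD _ _ i r r) (map_mx0 i _ _)).
    apply: eq_bigr => m _; rewrite map_mxM -Y0E; congr (_ *m _).
      by apply/matrixP => a b; rewrite mxE [X in i X]mxE kE [RHS]mxE.
    by apply/matrixP => a b; rewrite !mxE (iter_morph _ _ is0) id0.
  have := fundamental_map ps0 pd0 F0; rewrite (_ : (fun l => _) = (fun l => map_mx j (G l))) //.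
  apply/funext => l; apply/matrixP => a b.
  by rewrite mxE [X in p X]mxE [RHS]mxE.
split.
  move=> S Sj SD' SM' SY' Sdet; apply: genT => // a b.
  have dA : \det A' * \det Y' = 1 by rewrite -det_mulmx AY' det1.
  (* The required generators are the entries of Y' and the inverse of its determinant; Cramer's rule
     recovers the entries of A' from them. *)
  have -> : A' = \det A' *: \adj Y'.
    have E : A' *m (Y' *m \adj Y') = \adj Y' by rewrite mulmxA AY' mul1mx.
    by rewrite -E mul_mx_adj mul_mx_scalar scalerA dA scale1r.
  have S1 : S 1 by rewrite -(rmorph1 j).
  have SN1 : S (-1) by rewrite -(rmorphN1 j).
  rewrite mxE; apply: (SM'); first exact: Sdet.
  rewrite mxE /cofactor; apply: (SM').
    by move: (X in (-1) ^+ X) => m; elim: m => // m IH; rewrite exprS; apply: (SM').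
  by apply: det_closed => // a' b'; rewrite !mxE; have := SY' (lift b a') (lift a b'); rewrite mxE.
have gen' : generated j (mx_entries Y' ++ mx_entries A').
  move=> S Sj SD' SM' Sys; apply: genT => // a b; apply: Sys;
    by rewrite mem_cat mem_mx_entries ?orbT.
have [_ [_ dj]] := HTe.
move=> c; split=> [cc|[l cl <-] m m0]; last by rewrite dj cl // rmorph0.
exact: (constants_finitely_generated n_gt1 q_prim HL HTe simT gen' cc).
Qed.

End Existence.

Theorem theorem4p7 (C : closedFieldType) (n : nat) (q : C)
    (Hn : (2 <= n)%N) (Hq : n.-primitive_root q)
    (L : fieldType) (iL : {rmorphism Ct C -> L}) (sL : L -> L) (dL : nat -> L -> L)
    (HL : IDq_field_algclosed_consts q iL sL dL)
    (M : vectType L) (dM : nat -> M -> M) (HM : IDq_module q iL sL dL dM)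
    (e : (\dim (fullv : {vspace M})).-tuple M) (He : basis_of fullv e) :
  (exists (R : comNzRingType) (j : {rmorphism L -> R}) (s : R -> R)
          (d : nat -> R -> R) (Y : 'M[R]_(\dim (fullv : {vspace M}))),
      IDq_PV_ring q iL sL dL dM e j s d Y) /\
  (forall (R1 : comNzRingType) (j1 : {rmorphism L -> R1}) (s1 : R1 -> R1)
          (d1 : nat -> R1 -> R1) (Y1 : 'M[R1]_(\dim (fullv : {vspace M})))
          (R2 : comNzRingType) (j2 : {rmorphism L -> R2}) (s2 : R2 -> R2)
          (d2 : nat -> R2 -> R2) (Y2 : 'M[R2]_(\dim (fullv : {vspace M}))),
      IDq_PV_ring q iL sL dL dM e j1 s1 d1 Y1 ->
      IDq_PV_ring q iL sL dL dM e j2 s2 d2 Y2 ->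
      exists phi : {rmorphism R1 -> R2},
        [/\ bijective phi,
            (forall l, phi (j1 l) = j2 l) &
            (forall k x, phi (d1 k x) = d2 k (phi x))]).
Proof.
split; first exact: (IDq_PV_exists Hn Hq HL HM He).
move=> R1 j1 s1 d1 Y1 R2 j2 s2 d2 Y2 PV1 PV2.
exact: (IDq_PV_unique Hn Hq HL HM He PV1 PV2).
Qed.
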